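(* Let $S\subset[m]\times[n]$ be a zero pattern. Consider the variety $\mathcal{X}_1$ of complex $m\times n$ matrices of rank at most one and the intersection $\mathcal{L}_1^S=\mathcal{X}_1\cap\mathcal{L}^S$. Then $$\mathrm{EDdegree}(\mathcal{L}_1^S)=\sum_{(A_r,A_c)\in MC(S,m,n)}\min(m-|A_r|,\,n-|A_c|).$$
   Context: Notation: $[m]=\{1,\dots,m\}$. A zero pattern is a subset $S\subset[m]\times[n]$, and $\mathcal{L}^S=\{X=(x_{ij})\in\mathbb{C}^{m\times n}\mid x_{ij}=0\ \forall (i,j)\in S\}$. Rectangular patterns and covers: a zero pattern is rectangular if it has the form $(S_1\times[n])\cup([m]\times S_2)$ for some $S_1\subset[m]$, $S_2\subset[n]$ (i.e. the indices not in it form a rectangular submatrix); it is also denoted by the pair $(S_1,S_2)$. A zero pattern $T$ is a cover of $S$ if $S\subset T$ and $T$ is rectangular; it is a minimal cover of $S$ if it is minimal with respect to inclusion among all covers of $S$. $MC(S,m,n)$ denotes the set of all minimal covers of $S\subset[m]\times[n]$, written as pairs $(A_r,A_c)$ with $A_r\subset[m]$, $A_c\subset[n]$. ED degree: for $U=(u_{ij})\in\mathbb{C}^{m\times n}$ let $d_U(X)=\sum_{i,j}(x_{ij}-u_{ij})^2$. A critical point of $d_U$ on an algebraic variety $\mathcal{X}\subset\mathbb{C}^{m\times n}$ is a smooth point $X\in\mathcal{X}$ such that $U-X$ is orthogonal to the tangent space $T_X\mathcal{X}$ with respect to the complex bilinear form $\langle A,B\rangle_F=\mathrm{trace}(AB^T)$.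 $\mathrm{EDdegree}(\mathcal{X})$ is the number of critical points of $d_U$ on $\mathcal{X}$ for generic $U\in\mathbb{C}^{m\times n}$ (i.e. $U$ outside some proper Zariski closed set).
   Formalization: The zero pattern S is assumed different from the full pattern [m]×[n]; for the full pattern the variety is {0}, with ED degree 1, while the sum over minimal covers is 0, so the claim fails exactly there. *)

(* Defs.v *)
From HB Require Import structures.
From mathcomp Require Import all_boot all_order all_algebra.
From mathcomp Require Import boolp classical_sets functions cardinality reals.
From mathcomp Require Import complex.
From mathcomp Require Import mpoly.

Set Implicit Arguments.
Unset Strict Implicit.
Unset Printing Implicit Defensive.

Import Order.TTheory GRing.Theory Num.Theory.

Local Open Scope ring_scope.

Section ZeroPatterns.

Variables m n : nat.

Implicit Types (S T : {set 'I_m * 'I_n}) (A : {set 'I_m} * {set 'I_n}).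

Definition rect_pattern A : {set 'I_m * 'I_n} :=
  [set ij | (ij.1 \in A.1) || (ij.2 \in A.2)]%SET.

Definition rectangular T : bool := [exists A, T == rect_pattern A].

Definition is_cover S T : bool := (S \subset T) && rectangular T.

Definition minimal_cover S T : bool := minset (is_cover S) T.

(* A |-> rect_pattern A is injective on the pairs whose pattern is not full,
   so for S not full these pairs correspond one to one to minimal covers. *)
Definition MC S : {set {set 'I_m} * {set 'I_n}} :=
  [set A | minimal_cover S (rect_pattern A)]%SET.

End ZeroPatterns.

Local Open Scope classical_set_scope.

Section AffineVarieties.

Variables (C : closedFieldType) (m n : nat).

Implicit Types (X Z A B : set 'M[C]_(m, n)) (U V x : 'M[C]_(m, n)).
Implicit Types (p : {mpoly C[m * n]}).

(* The variable of index k stands for the matrix entry numbered k by mxvec. *)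
Definition mxeval p x : C := p.@[fun k => mxvec x 0 k].

Definition zero_locus (I : set {mpoly C[m * n]}) : set 'M[C]_(m, n) :=
  [set x | forall p, I p -> mxeval p x = 0].

Definition zariski_closed Z : Prop := exists I, Z = zero_locus I.

Definition zariski_irreducible Z : Prop :=
  Z !=set0 /\
  forall A B, zariski_closed A -> zariski_closed B ->
    Z `<=` A `|` B -> Z `<=` A \/ Z `<=` B.

Definition vanishing_ideal X : set {mpoly C[m * n]} :=
  [set p | forall x, X x -> mxeval p x = 0].

Definition differential p x V : C :=
  \sum_(i < m) \sum_(j < n) mxeval (mderiv (mxvec_index i j) p) x * V i j.

Definition tangent_space X x : set 'M[C]_(m, n) :=
  [set V | forall p, vanishing_ideal X p -> differential p x V = 0].

Definition irreducible_chain X x (d : nat) (F : nat -> set 'M[C]_(m, n)) :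
    Prop :=
  (forall i, (i <= d)%N ->
     [/\ zariski_closed (F i), zariski_irreducible (F i), F i x & F i `<=` X])
  /\ (forall i, (i < d)%N -> F i `<` F i.+1).

(* The dimension of X at x is the Krull dimension of the local ring of X at x,
   that is, the maximal length of a chain of irreducible closed subsets of X
   passing through x. X may be reducible, with components of different
   dimensions. *)
Definition local_dimension X x (d : nat) : Prop :=
  (exists F, irreducible_chain X x d F) /\
  (forall e F, irreducible_chain X x e F -> (e <= d)%N).

Definition smooth_point X x : Prop :=
  X x /\
  exists W : {vspace 'M[C]_(m, n)},
    (forall V, V \in W <-> tangent_space X x V) /\
    local_dimension X x (\dim W).

Definition frobenius_form U V : C := \tr (U *m V^T).

(* Critical points of d_U(x) = \sum_(i, j) (x i j - U i j) ^+ 2 on X. *)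
Definition critical_points X U : set 'M[C]_(m, n) :=
  [set x | smooth_point X x /\
     forall V, tangent_space X x V -> frobenius_form (U - x) V = 0].

(* The affine space is irreducible, so d is unique. *)
Definition has_EDdegree X (d : nat) : Prop :=
  exists Z, [/\ zariski_closed Z, Z <> setT &
    forall U, ~ Z U -> (critical_points X U #= `I_d)%card].

Definition pattern_space (S : {set 'I_m * 'I_n}) : set 'M[C]_(m, n) :=
  [set x : 'M[C]_(m, n) | forall i j, (i, j) \in S -> x i j = 0].

Definition rank_le1 : set 'M[C]_(m, n) := [set x | (\rank x <= 1)%N].

Definition rank_le1_pattern (S : {set 'I_m * 'I_n}) : set 'M[C]_(m, n) :=
  rank_le1 `&` pattern_space S.

End AffineVarieties.

Arguments rank_le1 C m n : clear implicits.
Arguments rank_le1_pattern C {m n} S.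

(* Main.v *)
Require Import Defs.
From HB Require Import structures.
From mathcomp Require Import all_boot all_order all_algebra.
From mathcomp Require Import boolp classical_sets functions cardinality reals.
From mathcomp Require Import complex.
From mathcomp Require Import mpoly.
From mathcomp Require Import separable ring zify.

(** Why the formula holds.  A matrix [u *m v] of rank at most one that vanishes
    on S also vanishes on the rectangular pattern formed by the zeros of u and
    of v, which is a cover of S.  Hence the variety X is the union, over the
    minimal covers A of S, of the cones X_A of matrices of rank at most one
    supported on the r x c rectangle that A leaves free, and what has to be
    shown is that for generic U each X_A contributes min(r, c) critical points,
    all different from those of the other cones.

    One cone.  A nonzero [u *m v] is critical for an r x c matrix U if and only
    if U v^T = (v v^T) u and u^T U = (u^T u) v.  Let r <= c and M = U U^T.  Then
    u is an eigenvector of M, and v = u^T U / (u^T u) is determined by u.  When the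
    characteristic polynomial p of M is separable, M has r eigenlines; as M is
    symmetric they are pairwise orthogonal and so none is isotropic, and they
    give exactly r critical points ([critical_rank1_seq]).  The case r > c
    follows by transposition.  If u or v has a zero entry, then u is an
    eigenvector, for the same eigenvalue, of the matrix M' obtained after
    replacing the corresponding row or column of U by 0; so all entries of the
    critical points are nonzero as soon as M and M' have no common eigenvalue.
    Each of these conditions is the nonvanishing of a polynomial in U: p is
    separable if and only if p'(M) is invertible, and M, M' have no common
    eigenvalue if and only if q(M) is invertible, where q is the characteristic
    polynomial of M'.  Two nonzero polynomials are simultaneously nonzero
    somewhere on a line, so it is enough to exhibit one matrix for each
    condition ([generic_good]).

    The union.  The tangent space of X at x contains the tangent spaces at x of
    all cones through x, so a critical point of X is critical on each of them;
    the point 0 is excluded since it would force U to vanish on a rectangle.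
    Conversely a critical point x of X_A for generic U has nonzero entries on
    the whole rectangle, hence lies on no other cone, and X agrees with X_A near
    x.  There X is smooth ([segre_smooth]): the 2 x 2 minors, multiplied by a
    polynomial vanishing on the other cones, cut the tangent space down to the
    matrices [a *m v + u *m b], which have dimension d = r + c - 1, and X has
    local dimension d at x.

    Local dimension.  Near x the variety is the image of a polynomial map phi
    in d variables.  The closures of the images under phi of a full flag of
    affine subspaces form a chain of length d ([chain_exists]).  Conversely,
    given a chain F_0 < ... < F_k through x, choose polynomials f_i that vanish
    on F_i but not on F_(i+1).  The monomials in f_0, ..., f_(k-1) are linearly
    independent on F_k ([independent_family]).  Composed with phi, the D^k
    monomials of exponents less than D become polynomials of degree O(D) in d
    variables, which span a space of dimension O(D^d); so k <= d
    ([chain_length_leq]). *)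

Set Implicit Arguments.
Unset Strict Implicit.
Unset Printing Implicit Defensive.

Import Order.TTheory GRing.Theory Num.Theory.

Local Open Scope ring_scope.
Local Open Scope classical_set_scope.

(** * Symmetric matrices with simple spectrum *)

Lemma char_poly_diag (R : comNzRingType) n (d : 'rV[R]_n) :
  char_poly (diag_mx d) = \prod_(i < n) ('X - (d 0 i)%:P).
Proof.
rewrite char_poly_trig ?diag_mx_is_trig //; apply: eq_bigr => i _.
by rewrite mxE eqxx mulr1n.
Qed.

Lemma mul_eigenrow_horner (F : fieldType) n (M : 'M[F]_n.+1) (u : 'rV_n.+1)
    (a : F) (p : {poly F}) :
  u *m M = a *: u -> u *m horner_mx M p = p.[a] *: u.
Proof.
move=> uM; elim/poly_ind: p => [|p c IHp].
  by rewrite rmorph0 horner0 mulmx0 scale0r.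
rewrite rmorphD rmorphM /= horner_mx_X horner_mx_C hornerMXaddC mulmxDr.
by rewrite mulmxA IHp -scalemxAl uM scalerA scalerDl mul_mx_scalar.
Qed.

(** Invertibility of p(M) is how conditions on the eigenvalues of M are made
    polynomial in the entries of M. *)
Lemma unit_eigenrow (F : fieldType) n (M : 'M[F]_n.+1) (u : 'rV_n.+1)
    (a : F) (p : {poly F}) :
  u *m M = a *: u -> u != 0 -> \det (horner_mx M p) != 0 -> p.[a] != 0.
Proof.
move=> uM u0 dM; apply: contraNneq u0 => pa0.
rewrite -unitfE -unitmxE in dM.
have := mul_eigenrow_horner p uM; rewrite pa0 scale0r => /eqP.
by move=> /eqP/(congr1 (mulmx^~ (invmx (horner_mx M p)))); rewrite mulmxK // mul0mx => ->.
Qed.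

Lemma char_poly_uniq_roots (C : closedFieldType) n (M : 'M[C]_n.+1) :
    \det (horner_mx M (char_poly M)^`()) != 0 ->
  exists2 rs, uniq rs & char_poly M = \prod_(z <- rs) ('X - z%:P).
Proof.
move=> dM; have [rs rsE] := closed_field_poly_normal (char_poly M).
rewrite (monicP (char_poly_monic M)) scale1r in rsE.
exists rs => //; rewrite -separable_prod_XsubC -rsE unlock.
apply/Pdiv.ClosedField.coprimepP => z z_root.
have /eigenvalueP[u uM u0] : eigenvalue M z by rewrite eigenvalue_root_char.
exact: unit_eigenrow uM u0 dM.
Qed.

(** Eigenvectors of a symmetric matrix for distinct eigenvalues are orthogonal,
    so the rows of P are pairwise orthogonal.  An isotropic row would then be
    orthogonal to all rows, hence zero. *)
Lemma symmetric_diagonalization (C : closedFieldType) n (M : 'M[C]_n.+1) :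
    M^T = M -> \det (horner_mx M (char_poly M)^`()) != 0 ->
  exists (P : 'M[C]_n.+1) (d : 'rV[C]_n.+1), [/\ P \in unitmx,
    injective (fun i => d 0 i),
    (forall i, row i P *m M = d 0 i *: row i P) &
    forall i, (row i P *m (row i P)^T) 0 0 != 0].
Proof.
move=> Msym dM; have [rs rs_uniq rsE] := char_poly_uniq_roots dM.
have /diagonalizableP[P Pu] : exists2 rs, uniq rs &
    (mxminpoly M %| \prod_(x <- rs) ('X - x%:P))%R.
  by exists rs; rewrite -?rsE ?mxminpoly_dvd_char.
case/diagonalizable_forPex => d /(simmxP Pu) PM.
have cE : char_poly M = \prod_(i < n.+1) ('X - (d 0 i)%:P).
  have <- : char_poly (diag_mx d) = char_poly M.
    rewrite -(mulmxK Pu (diag_mx d)) -PM /char_poly /char_poly_mx.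
    have -> : 'X%:M - map_mx (@polyC C) (P *m M *m invmx P) =
        map_mx (@polyC C) P *m ('X%:M - map_mx (@polyC C) M) *m map_mx (@polyC C) (invmx P).
      rewrite mulmxBr mulmxBl !map_mxM scalar_mxC -!mulmxA -(map_mxM _ P) mulmxV //.
      by rewrite map_mx1 mulmx1.
    rewrite !det_mulmx mulrAC -det_mulmx -map_mxM mulmxV //.
    by rewrite map_mx1 det1 mul1r.
  exact: char_poly_diag.
have d_inj : injective (fun i => d 0 i).
  have : uniq [seq d 0 i | i <- enum 'I_n.+1].
    rewrite -separable_prod_XsubC big_map big_enum /= -cE rsE.
    by rewrite separable_prod_XsubC.
  by move/injectiveP.
have PiM i : row i P *m M = d 0 i *: row i P.
  by rewrite -row_mul PM row_mul row_diag_mx -scalemxAl -rowE.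
exists P, d; split=> // i; apply/eqP => Pi0.
have orth j : j != i -> (row i P *m (row j P)^T) 0 0 = 0.
  move=> ji; have : row i P *m M *m (row j P)^T = row i P *m (row j P *m M)^T.
    by rewrite trmx_mul Msym mulmxA.
  rewrite !PiM linearZ /= -scalemxAl -scalemxAr => /matrixP/(_ 0 0)/eqP.
  rewrite !mxE -subr_eq0 -mulrBl mulf_eq0 subr_eq0 (inj_eq d_inj).
  by rewrite eq_sym (negPf ji) => /eqP.
have : row i P *m P^T = 0.
  apply/rowP => j; rewrite [RHS]mxE.
  have -> : (row i P *m P^T) 0 j = (row i P *m (row j P)^T) 0 0.
    by rewrite !mxE; apply: eq_bigr => k _; rewrite !mxE.
  by have [->//|/orth] := eqVneq j i.
move/(congr1 (mulmx^~ (invmx P^T))); rewrite mulmxK ?unitmx_tr // mul0mx.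
move/(congr1 (mulmx^~ (invmx P))); rewrite rowE mulmxK // mul0mx.
by move/matrixP/(_ 0 i)/eqP; rewrite !mxE !eqxx oner_eq0.
Qed.

(** * Critical points of rank one *)

(** The equations say that [U - x] is orthogonal, for the trace form, to all
    matrices [a *m v + u *m b], which form the tangent space at x of the matrices
    of rank at most one; see [frobenius_segre]. *)
Definition critical_rank1 (C : fieldType) r c (U x : 'M[C]_(r, c)) : Prop :=
  exists (u : 'cV[C]_r) (v : 'rV[C]_c),
    [/\ x = u *m v, x != 0, U *m v^T = u *m (v *m v^T)
      & u^T *m U = (u^T *m u) *m v].

Lemma critical_rank1_tr (C : fieldType) r c (U x : 'M[C]_(r, c)) :
  critical_rank1 U x -> critical_rank1 U^T x^T.
Proof.
case=> u [v [-> x0 Uv uU]]; exists v^T, u^T; split.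
- by rewrite trmx_mul.
- by apply: contraNneq x0 => /(congr1 trmx); rewrite trmxK trmx0 => ->.
- by apply: trmx_inj; rewrite !trmx_mul !trmxK.
- by apply: trmx_inj; rewrite !trmx_mul !trmxK Uv mulmxA.
Qed.

Section Tests.
Variables (R : comNzRingType) (r c : nat).
Implicit Types (U : 'M[R]_(r.+1, c)) (P : pred 'I_r.+1) (Q : pred 'I_c).

Definition gram U := U *m U^T.

Definition mask P Q U := \matrix_(k, l) (U k l *+ (P k && Q l)).

Definition disc_test U := \det (horner_mx (gram U) (char_poly (gram U))^`()).

(** Over an algebraically closed field this is nonzero exactly when U and U
    masked outside [P x Q] have Gram matrices without common eigenvalue. *)
Definition mask_test P Q U :=
  \det (horner_mx (gram U) (char_poly (gram (mask P Q U)))).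

End Tests.

(** The tests are polynomial in the entries of U.  This is expressed by their
    compatibility with ring morphisms: applied to the matrix of indeterminates
    they give a polynomial, whose values are the values of the test. *)
Section Naturality.
Variables (R R' : comNzRingType) (f : {rmorphism R -> R'}) (r c : nat).
Implicit Types (U : 'M[R]_(r.+1, c)) (P : pred 'I_r.+1) (Q : pred 'I_c).

Lemma map_gram U : map_mx f (gram U) = gram (map_mx f U).
Proof. by rewrite /gram map_mxM map_trmx. Qed.

Lemma map_mask P Q U : map_mx f (mask P Q U) = mask P Q (map_mx f U).
Proof. by apply/matrixP => k l; rewrite !mxE raddfMn. Qed.

Lemma rmorph_disc_test U : f (disc_test U) = disc_test (map_mx f U).
Proof.
by rewrite /disc_test -det_map_mx map_horner_mx -deriv_map map_char_poly map_gram.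
Qed.

Lemma rmorph_mask_test P Q U :
  f (mask_test P Q U) = mask_test P Q (map_mx f U).
Proof.
rewrite /mask_test -det_map_mx map_horner_mx map_char_poly !map_gram.
by rewrite map_mask.
Qed.

End Naturality.

Section RankOne.
Variables (C : closedFieldType) (r c : nat).
Implicit Types (U : 'M[C]_(r.+1, c)) (w : 'rV[C]_r.+1).

Lemma gram_sym U : (gram U)^T = gram U.
Proof. by rewrite trmx_mul trmxK. Qed.

(** If an eigenvector w is supported on P and [w *m U] on Q, masking U outside
    [P x Q] changes neither [w *m U] nor [w *m U *m U^T], so that the masked
    matrix has a Gram matrix with the same eigenvalue. *)
Lemma mask_test_support P Q U w a : w *m gram U = a *: w -> w != 0 ->
    mask_test P Q U != 0 ->
    (forall k, ~~ P k -> w 0 k = 0) -> (forall l, ~~ Q l -> (w *m U) 0 l = 0) ->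
  False.
Proof.
move=> wM w0 dM wP wQ.
have wU : w *m mask P Q U = w *m U.
  apply/rowP => l; have [Ql|/[dup] Ql /wQ->] := boolP (Q l); rewrite !mxE.
    apply: eq_bigr => k _; rewrite mxE Ql andbT.
    by have [//|/wP->] := boolP (P k); rewrite !mul0r.
  by apply: big1 => k _; rewrite mxE (negPf Ql) andbF mulr0.
have wM' : w *m gram (mask P Q U) = a *: w.
  rewrite /gram mulmxA wU -wM; apply/rowP => k.
  have [Pk|Pk] := boolP (P k).
    rewrite mulmxA !(mxE, summxE); apply: eq_bigr => l _; rewrite 3!mxE Pk /=.
    have [//|Ql] := boolP (Q l); first by rewrite mxE.
    by have := wQ l Ql; rewrite !mxE => ->; rewrite !mul0r.
  rewrite wM [RHS]mxE wP // mulr0 mxE big1 // => l _.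
  by rewrite !mxE (negPf Pk) mulr0.
have := unit_eigenrow wM w0 dM; apply/negP; rewrite negbK.
rewrite -rootE -eigenvalue_root_char; apply/eigenvalueP.
by exists w.
Qed.

Lemma mulmx11 (F : comNzRingType) n (a : 'M[F]_1) (v : 'rV_n) : a *m v = a 0 0 *: v.
Proof. by rewrite [a in LHS]mx11_scalar mul_scalar_mx. Qed.

(** The critical equations give u^T M = (u^T u) (v v^T) u^T, so u^T is an
    eigenvector of M = U U^T, and v is u^T U divided by u^T u, which is nonzero
    as M is invertible.  Scaling u does not change [u *m v]; so the critical
    points correspond to the eigenlines of M. *)
Lemma critical_rank1_seq U :
    \det (gram U) != 0 -> disc_test U != 0 ->
    (forall i, mask_test (predC1 i) xpredT U != 0) ->
    (forall j, mask_test xpredT (predC1 j) U != 0) ->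
  exists s : seq 'M[C]_(r.+1, c), [/\ uniq s, size s = r.+1,
    forall x, x \in s <-> critical_rank1 U x &
    forall x i j, x \in s -> x i j != 0].
Proof.
move=> d0 d1 d2 d3.
have [P [d [Pu d_inj PM PP]]] := symmetric_diagonalization (gram_sym U) d1.
pose n2 i : C := (row i P *m (row i P)^T) 0 0.
pose b i : 'rV_c := (n2 i)^-1 *: (row i P *m U).
pose x i := (row i P)^T *m b i.
have P0 i : row i P != 0.
  by apply: contraNneq (PP i) => ->; rewrite mul0mx mxE.
have di0 i : d 0 i != 0.
  apply: contraNneq (P0 i) => di; have := PM i; rewrite di scale0r => /eqP.
  move: d0; rewrite -unitfE -unitmxE => Mu.
  by move=> /eqP/(congr1 (mulmx^~ (invmx (gram U)))); rewrite mulmxK // mul0mx => ->.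
have PiU i : row i P *m U = n2 i *: b i by rewrite scalerA mulfV ?PP ?scale1r.
have bU i : U *m (b i)^T = (d 0 i / n2 i) *: (row i P)^T.
  rewrite linearZ /= -scalemxAr trmx_mul mulmxA -[U *m U^T]/(gram U).
  by rewrite -{1}(gram_sym U) -trmx_mul PM linearZ /= scalerA mulrC.
have bb i : (b i *m (b i)^T) = (d 0 i / n2 i)%:M.
  rewrite {1}/b -scalemxAl -mulmxA bU -scalemxAr scalerA.
  rewrite [_ *m _]mx11_scalar -/(n2 i) -mul_scalar_mx -scalar_mxM.
  by rewrite mulrAC mulVf ?PP // mul1r.
have b0 i : b i != 0.
  apply/eqP => bi; have := bb i; rewrite bi mul0mx => /matrixP/(_ 0 0)/esym/eqP.
  by rewrite !mxE mulr1n mulf_eq0 invr_eq0 (negPf (di0 i)) (negPf (PP i)).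
have Px i : row i P *m x i = n2 i *: b i.
  by rewrite /x mulmxA mulmx11.
have xi_entry i k l : x i k l != 0.
  have -> : x i k l = P i k * b i 0 l.
    by rewrite /x mxE big_ord1 !mxE.
  rewrite mulf_neq0 //; apply/eqP => E0.
    apply: (mask_test_support (PM i) (P0 i) (d2 k)) => [k'|//].
    by rewrite negbK => /eqP->; rewrite mxE.
  apply: (mask_test_support (PM i) (P0 i) (d3 l)) => [//|l'].
  by rewrite negbK => /eqP->; rewrite PiU mxE E0 mulr0.
have x0 i : x i != 0.
  apply/eqP => xi0; have := Px i; rewrite xi0 mulmx0 => /esym/eqP.
  by rewrite scaler_eq0 (negPf (b0 i)) (negPf (PP i)).
have x_inj : injective x.
  move=> i j xij; apply/eqP/negPn/negP => ij.
  have : row i P *m (row j P)^T = 0.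
    rewrite [LHS]mx11_scalar; apply/eqP; rewrite -scalemx1 scaler_eq0; apply/orP; left.
    have : row i P *m gram U *m (row j P)^T = row i P *m (row j P *m gram U)^T.
      by rewrite trmx_mul gram_sym -mulmxA.
    rewrite !PM linearZ /= -scalemxAl -scalemxAr => /matrixP/(_ 0 0)/eqP.
    rewrite [X in X == _]mxE [X in _ == X]mxE -subr_eq0 -mulrBl mulf_eq0.
    by rewrite subr_eq0 (inj_eq d_inj) (negPf ij).
  move=> orth; have := Px i; rewrite xij /x mulmxA orth mul0mx => /esym/eqP.
  by rewrite scaler_eq0 (negPf (b0 i)) (negPf (PP i)).
exists [seq x i | i <- enum 'I_r.+1]; split.
- by rewrite map_inj_uniq ?enum_uniq.
- by rewrite size_map size_enum_ord.
- move=> y; split=> [/mapP[i _ ->]|[u [v [-> y0 Uv uU]]]].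
    exists (row i P)^T; exists (b i); split=> //.
      by rewrite bU bb mul_mx_scalar.
    by rewrite trmxK PiU mulmx11.
  have u0 : u^T != 0.
    by apply: contraNneq y0 => u0; rewrite -[u]trmxK u0 trmx0 mul0mx.
  have uMa : u^T *m gram U = ((u^T *m u) 0 0 * (v *m v^T) 0 0) *: u^T.
    rewrite /gram mulmxA uU mulmx11 -scalemxAl -[v *m U^T]trmxK trmx_mul trmxK.
    rewrite Uv trmx_mul [v *m v^T]mx11_scalar tr_scalar_mx mul_scalar_mx.
    by rewrite scalerA !mxE eqxx mulr1n.
  have uu0 : (u^T *m u) 0 0 != 0.
    apply: contraNneq u0 => uu; move: uMa; rewrite uu mul0r scale0r => /eqP.
    move: d0; rewrite -unitfE -unitmxE => Mu.
    by move=> /eqP/(congr1 (mulmx^~ (invmx (gram U)))); rewrite mulmxK // mul0mx => ->.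
  set a := _ * _ in uMa.
  pose t := u^T *m invmx P.
  have uE : u^T = t *m P by rewrite mulmxKV.
  have td i : t 0 i * d 0 i = a * t 0 i.
    have : t *m diag_mx d = a *: t.
      have PMd : P *m gram U = diag_mx d *m P.
        by apply/row_matrixP => k; rewrite !row_mul PM row_diag_mx -scalemxAl -rowE.
      have : t *m (diag_mx d *m P) = a *: t *m P.
        by rewrite -PMd mulmxA -uE uMa -scalemxAl -uE.
      by rewrite mulmxA => /(congr1 (mulmx^~ (invmx P))); rewrite !mulmxK.
    by move/rowP/(_ i); rewrite mul_mx_diag !mxE.
  have [i ti] : exists i, t 0 i != 0.
    apply/existsP; apply: contraNT u0; rewrite negb_exists => /forallP t0.
    rewrite uE (_ : t = 0) ?mul0mx //; apply/rowP => k; rewrite [RHS]mxE.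
    by apply/eqP; have := t0 k; rewrite negbK.
  have ai : d 0 i = a by apply: (mulIf ti); rewrite mulrC td.
  have uP : u^T = t 0 i *: row i P.
    rewrite uE mulmx_sum_row (bigD1 i) //= big1 ?addr0 // => k ki.
    suff -> : t 0 k = 0 by rewrite scale0r.
    apply/eqP; apply: contraNT ki => tk.
    by apply/eqP/d_inj; apply: (mulIf tk); rewrite mulrC td ai.
  apply/mapP; exists i; rewrite ?mem_enum //.
  have uE' : u = t 0 i *: (row i P)^T by rewrite -[u]trmxK uP linearZ.
  have vE : v = (t 0 i)^-1 *: b i.
    move: uU uu0; rewrite mulmx11; set k := (_ 0 0) => uU k0.
    apply: (scalerI k0); rewrite -uU scalerA uP -scalemxAl PiU scalerA.
    have -> : k = t 0 i ^+ 2 * n2 i.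
      rewrite /k uP uE' -scalemxAl -scalemxAr scalerA mxE expr2.
      by rewrite -[X in _ * X]/(n2 i).
    by congr (_ *: _); rewrite expr2 mulrAC mulfK.
  by rewrite uE' vE -scalemxAl -scalemxAr scalerA mulfV // scale1r.
- by move=> y i j /mapP[k _ ->].
Qed.

End RankOne.

(** * Matrices passing the tests *)

(** Here M - d_k is invertible for each k, and evaluating the characteristic
    polynomial at M gives the product of these matrices. *)
Lemma unit_horner_char_diag (F : fieldType) n (M : 'M[F]_n.+1) p (d : 'rV[F]_p) :
  (forall k (w : 'rV_n.+1), w *m M = d 0 k *: w -> w = 0) ->
  \det (horner_mx M (char_poly (diag_mx d))) != 0.
Proof.
move=> inj; rewrite -unitfE -unitmxE char_poly_diag rmorph_prod.
rewrite -[_ \in unitmx]/(_ \is a GRing.unit) rpred_prod // => k _.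
rewrite rmorphB /= horner_mx_X horner_mx_C.
rewrite -[X in is_true X]/(M - (d 0 k)%:M \in unitmx) -row_free_unit.
apply: inj_row_free => w; rewrite mulmxBr mul_mx_scalar => /subr0_eq; exact: inj.
Qed.

Section Examples.
Variables (C : numClosedFieldType) (r c : nat) (le_rc : (r.+1 <= c)%N).
Implicit Types (P : pred 'I_r.+1) (Q : pred 'I_c).
Local Notation wd := (widen_ord le_rc).

(** Masking turns it into a diagonal matrix with distinct squares, possibly
    with one zero row or column.  The ones in the masked positions couple all
    coordinates, so that no eigenvalue of the masked matrix survives. *)
Definition example_mx P Q : 'M[C]_(r.+1, c) :=
  \matrix_(k, l) if P k && Q l then k.+1%:R *+ (wd k == l) else 1.

Definition example_eig P Q : 'rV[C]_r.+1 :=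
  \row_k (k.+1%:R ^+ 2 *+ (P k && Q (wd k))).

Lemma wd_inj : injective wd.
Proof. by move=> k l /(congr1 val) /= /val_inj. Qed.

Lemma gram_example P Q : gram (mask P Q (example_mx P Q)) = diag_mx (example_eig P Q).
Proof.
apply/matrixP => k l; rewrite !mxE (bigD1 (wd k)) //= big1 ?addr0.
  rewrite !mxE !(inj_eq wd_inj) eqxx.
  have [->|kl] := eqVneq k l.
    by case: ifP; rewrite ?eqxx ?mulr0n ?mul0r // mulr1n expr2.
  by case: (P l && _); rewrite ?mulr0n mulr0 ?mul0rn ?mulr0n.
move=> j; rewrite !mxE => /negPf; rewrite eq_sym => ->.
by case: (P k && _); rewrite ?mulr0n mul0r.
Qed.

Lemma sqrS_inj k l : k.+1%:R ^+ 2 = l.+1%:R ^+ 2 :> C -> k = l.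
Proof.
move/eqP; rewrite -!natrX eqr_nat eqn_exp2r // => /eqP; exact: succn_inj.
Qed.

Lemma disc_test_example : disc_test (example_mx xpredT xpredT) != 0.
Proof.
have maskE : mask xpredT xpredT (example_mx xpredT xpredT) = example_mx xpredT xpredT.
  by apply/matrixP => k l; rewrite mxE.
rewrite /disc_test -{1 2}maskE gram_example horner_mx_diag det_diag.
set d := example_eig _ _; rewrite prodf_seq_neq0; apply/allP => k _ /=.
rewrite mxE; apply: (@coprimep_root _ (char_poly (diag_mx d))); last first.
  by rewrite char_poly_diag rootE horner_prod (bigD1 k) //= hornerXsubC subrr mul0r.
rewrite char_poly_diag -(big_image _ _ _ _ (fun z => 'X - z%:P)) /=.
have := separable_prod_XsubC [seq d 0 i | i : 'I_r.+1]; rewrite unlock => ->.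
apply/injectiveP => i j; rewrite !mxE !mulr1n => /sqrS_inj; exact: val_inj.
Qed.

Lemma mulmx_gram (w : 'rV[C]_r.+1) (U : 'M_(r.+1, c)) k :
  (w *m gram U) 0 k = \sum_l (w *m U) 0 l * U k l.
Proof. by rewrite mulmxA mxE; apply: eq_bigr => l _; rewrite [U^T _ _]mxE. Qed.

(** The Gram matrix of U is [diag_mx d + const_mx 1]: an eigenvector for the
    eigenvalue [d 0 k] has coordinate sum 0 (compare k-th coordinates), hence is
    concentrated in position k, hence zero. *)
Lemma mask_test_col_example j :
  mask_test xpredT (predC1 j) (example_mx xpredT (predC1 j)) != 0.
Proof.
set U := example_mx _ _; rewrite /mask_test gram_example.
set d := example_eig _ _; apply: unit_horner_char_diag => k w wM.
have wU l : (w *m U) 0 (wd l) = if wd l == j then \sum_i w 0 i else w 0 l * l.+1%:R.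
  rewrite mxE; case: eqP => [lj|/eqP lj].
    by apply: eq_bigr => i _; rewrite !mxE lj /= eqxx mulr1.
  rewrite (bigD1 l) //= !mxE eqxx /= lj mulr1n big1 ?addr0 // => i il.
  by rewrite !mxE /= lj (inj_eq wd_inj) (negPf il) mulr0.
have wUj : (w *m U) 0 j = \sum_i w 0 i.
  by rewrite mxE; apply: eq_bigr => i _; rewrite !mxE /= eqxx mulr1.
have eq1 l : w 0 l * d 0 l + \sum_i w 0 i = d 0 k * w 0 l.
  have := congr1 (fun v : 'rV_r.+1 => v 0 l) wM.
  rewrite mulmx_gram [RHS]mxE => <-.
  have Ulj : U l j = 1 by rewrite mxE /= eqxx.
  rewrite (bigD1 j) //= wUj Ulj mulr1 addrC; congr (_ + _).
  have [lj|lj] := eqVneq (wd l) j.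
    rewrite mxE /= ?lj ?eqxx mulr0 big1 // => i ij.
    by rewrite [U _ _]mxE /= ij lj eq_sym (negPf ij) mulr0.
  rewrite (bigD1 (wd l)) //= wU (negPf lj) big1 ?addr0; last first.
    by move=> i /andP[ij il]; rewrite [U _ _]mxE /= ij eq_sym (negPf il) mulr0.
  by rewrite !mxE /= lj eqxx !mulr1n expr2 mulrA.
have s0 : \sum_i w 0 i = 0.
  by apply: (addrI (w 0 k * d 0 k)); rewrite eq1 addr0 mulrC.
have wl l : l != k -> w 0 l = 0.
  move=> lk; have := eq1 l; rewrite s0 addr0 mulrC => /eqP.
  rewrite -subr_eq0 -mulrBl mulf_eq0 => /orP[|/eqP//].
  rewrite subr_eq0 !mxE /= => /eqP dlk; case/eqP: lk.
  move: dlk; case: eqP => [lj|_]; case: eqP => [kj|_]; rewrite ?mulr0n ?mulr1n.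
  - by move=> _; apply: wd_inj; rewrite lj kj.
  - by move/esym/eqP; rewrite expf_eq0 pnatr_eq0.
  - by move/eqP; rewrite expf_eq0 pnatr_eq0.
  - by move/sqrS_inj/val_inj.
apply/rowP => l; rewrite [RHS]mxE; have [->|/wl//] := eqVneq l k.
by move: s0; rewrite (bigD1 k) //= big1 ?addr0.
Qed.

(** Row i of U consists of ones.  If an eigenvector w has an eigenvalue
    [d 0 k] with k different from i, the k-th coordinate shows [w 0 i = 0], and
    then w is concentrated in position k, which the i-th coordinate rules out.
    The eigenvalue [d 0 i = 0] does not occur either: [w *m U] would vanish in
    the column of each row other than i, and the sum of its other entries is a
    positive multiple of [w 0 i]. *)
Lemma mask_test_row_example i :
  mask_test (predC1 i) xpredT (example_mx (predC1 i) xpredT) != 0.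
Proof.
set U := example_mx _ _; rewrite /mask_test gram_example.
set d := example_eig _ _; apply: unit_horner_char_diag => k w wM.
have Ui j : U i j = 1 by rewrite mxE /= eqxx.
have Ul l j : l != i -> U l j = l.+1%:R *+ (wd l == j) by move=> li; rewrite mxE /= li.
have wU j : (forall l, wd l != j) -> (w *m U) 0 j = w 0 i.
  move=> jr; rewrite mxE (bigD1 i) //= Ui mulr1 big1 ?addr0 // => l li.
  by rewrite Ul // (negPf (jr l)) mulr0.
have wUl l : (w *m U) 0 (wd l) = w 0 i + (w 0 l * l.+1%:R *+ (l != i)).
  rewrite mxE (bigD1 i) //= Ui mulr1; congr (_ + _).
  have [->|li] := eqVneq l i.
    by rewrite big1 // => j ji; rewrite Ul // (inj_eq wd_inj) (negPf ji) mulr0.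
  rewrite (bigD1 l) //= Ul // eqxx big1 ?addr0 // => j /andP[ji jl].
  by rewrite Ul // (inj_eq wd_inj) (negPf jl) mulr0.
have eql l : l != i -> (w 0 i + w 0 l * l.+1%:R) * l.+1%:R = d 0 k * w 0 l.
  move=> li; have := congr1 (fun v : 'rV_r.+1 => v 0 l) wM.
  rewrite mulmx_gram [RHS]mxE => <-; rewrite (bigD1 (wd l)) //= wUl li mulr1n.
  rewrite Ul // eqxx big1 ?addr0 // => j jl.
  by rewrite Ul // eq_sym (negPf jl) mulr0.
have eqi : \sum_j (w *m U) 0 j = d 0 k * w 0 i.
  have := congr1 (fun v : 'rV_r.+1 => v 0 i) wM.
  rewrite mulmx_gram [RHS]mxE => <-; apply: eq_bigr => j _.
  by rewrite Ui mulr1.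
have S0 l : l.+1%:R != 0 :> C by rewrite pnatr_eq0.
have [ki|ki] := eqVneq k i.
  have dk0 : d 0 k = 0 by rewrite mxE ki /= eqxx.
  have wil l : l != i -> w 0 i + w 0 l * l.+1%:R = 0.
    by move=> li; apply: (mulIf (S0 l)); rewrite eql // dk0 !mul0r.
  have wi0 : w 0 i = 0.
    (* the columns where w *m U has entry w 0 i: column i and the last ones *)
    pose A := [pred j | [forall l, (l != i) ==> (wd l != j)]].
    have : \sum_(j in A) w 0 i = d 0 k * w 0 i.
      rewrite -eqi [RHS](bigID (mem A)) /=.
      rewrite [X in _ = _ + X]big1 ?addr0.
        apply: eq_bigr => j /forallP Aj; have [ji|ji] := eqVneq j (wd i).
          by rewrite ji wUl eqxx addr0.
        rewrite wU // => l; have := Aj l; have [->|//] := eqVneq l i.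
        by rewrite eq_sym.
      move=> j; rewrite negb_forall => /existsP[l]; rewrite negb_imply negbK.
      by case/andP=> li /eqP <-; rewrite wUl li wil.
    rewrite dk0 mul0r sumr_const => /eqP; rewrite mulrn_eq0 => /orP[/eqP A0|/eqP//].
    have : wd i \in A by apply/forallP => l; rewrite (inj_eq wd_inj); apply/implyP.
    by rewrite (card0_eq A0).
  apply/rowP => l; rewrite [RHS]mxE; have [->//|li] := eqVneq l i.
  by apply: (mulIf (S0 l)); have := wil l li; rewrite wi0 add0r mul0r.
have dE l : l != i -> d 0 l = l.+1%:R ^+ 2 by move=> li; rewrite mxE /= li.
have wi0 : w 0 i = 0.
  apply: (mulIf (S0 k)); rewrite mul0r; apply: (addIr (d 0 k * w 0 k)).
  rewrite add0r -[in RHS](eql k ki) (dE k ki); ring.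
have wl l : l != k -> w 0 l = 0.
  move=> lk; have [->//|li] := eqVneq l i.
  have := eql l li; rewrite wi0 add0r dE // -mulrA -expr2 mulrC => /eqP.
  rewrite -subr_eq0 -mulrBl mulf_eq0 => /orP[|/eqP//].
  by rewrite subr_eq0 => /eqP/sqrS_inj/val_inj lk'; rewrite lk' eqxx in lk.
apply/rowP => l; rewrite [RHS]mxE; have [->|/wl//] := eqVneq l k.
move: eqi; rewrite wi0 mulr0 (bigD1 (wd k)) //= wUl ki wi0 add0r mulr1n.
rewrite big1 ?addr0 => [/eqP|j jk].
  by rewrite mulf_eq0 (negPf (S0 k)) orbF => /eqP.
rewrite mxE big1 // => l' _; have [->|l'i] := eqVneq l' i; first by rewrite wi0 mul0r.
have [->|/wl->] := eqVneq l' k; last by rewrite mul0r.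
by rewrite Ul // eq_sym (negPf jk) mulr0.
Qed.

Lemma det_gram_example : \det (gram (example_mx xpredT xpredT)) != 0.
Proof.
have maskE : mask xpredT xpredT (example_mx xpredT xpredT) = example_mx xpredT xpredT.
  by apply/matrixP => k l; rewrite mxE.
rewrite -maskE gram_example det_diag prodf_seq_neq0; apply/allP => k _ /=.
by rewrite mxE mulr1n expf_eq0 pnatr_eq0.
Qed.

End Examples.

(** * Polynomial functions on matrices and generic properties *)

Lemma mmap_eval (C A : comNzRingType) N (f : {rmorphism C -> A})
    (g : {rmorphism A -> C}) (h : 'I_N -> A) (p : {mpoly C[N]}) :
  cancel f g -> g (mmap f h p) = p.@[fun k => g (h k)].
Proof.
move=> fK; rewrite /mmap mevalE rmorph_sum.
apply: eq_bigr => k _; rewrite rmorphM fK /mmap1 rmorph_prod; congr (_ * _).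
by apply: eq_bigr => i _; rewrite rmorphXn.
Qed.

(** On the line through v and w both polynomials restrict to nonzero univariate
    polynomials, whose product has a point that is not a root. *)
Lemma mpoly_line_neq0 (C : closedFieldType) N (p q : {mpoly C[N]}) v w :
    p.@[v] != 0 -> q.@[w] != 0 ->
  exists s, let z k := v k + s * (w k - v k) in p.@[z] != 0 /\ q.@[z] != 0.
Proof.
move=> pv qw; pose h k : {poly C} := (v k)%:P + 'X * (w k - v k)%:P.
have hE r s : (mmap polyC h r).[s] = r.@[fun k => v k + s * (w k - v k)].
  rewrite -[LHS]/(horner_eval s _) (mmap_eval (f := polyC)) => [|a].
    by apply: meval_eq => k; rewrite /h /= /horner_eval !hornerE.
  exact: hornerC.
have [s] : exists s, ~~ root (mmap polyC h p * mmap polyC h q) s.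
  apply/closed_nonrootP; rewrite mulf_neq0 //.
    apply: contraNneq pv => p0; have := hE p 0; rewrite p0 horner0 => ->.
    by apply/eqP/meval_eq => k; rewrite mul0r addr0.
  apply: contraNneq qw => q0; have := hE q 1; rewrite q0 horner0 => ->.
  by apply/eqP/meval_eq => k; rewrite mul1r addrC subrK.
by rewrite rootE hornerM !hE mulf_eq0 negb_or => /andP[ps qs]; exists s.
Qed.

(** The target A is the ring of univariate polynomials for curves of matrices,
    a ring of multivariate polynomials for parametrizations. *)
Definition mxsubst (C A : comNzRingType) m n (f : C -> A) (x : 'M[A]_(m, n))
    (p : {mpoly C[m * n]}) : A :=
  mmap f (fun k => mxvec x 0 k) p.

Section Substitution.
Variables (C : closedFieldType) (A : comNzRingType) (m n : nat).
Variables (f : {rmorphism C -> A}) (x : 'M[A]_(m, n)).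

HB.instance Definition _ := GRing.RMorphism.copy (mxsubst f x)
  (mmap f (fun k => mxvec x 0 k)).

Lemma mxsubst_eval (g : {rmorphism A -> C}) p : cancel f g ->
  g (mxsubst f x p) = mxeval p (map_mx g x).
Proof.
move=> fK; rewrite /mxsubst mmap_eval //.
by apply: meval_eq => k; rewrite -map_mxvec mxE.
Qed.

Definition coord_poly (i : 'I_m) (j : 'I_n) : {mpoly C[m * n]} :=
  'X_(mxvec_index i j).

Lemma mxsubst_coord i j : mxsubst f x (coord_poly i j) = x i j.
Proof. by rewrite /mxsubst mmapX mmap1U mxvecE. Qed.

Lemma mxevalX (U : 'M[C]_(m, n)) i j : mxeval (coord_poly i j) U = U i j.
Proof. by rewrite /mxeval mevalXU mxvecE. Qed.

Definition generic_mx := \matrix_(i, j) coord_poly i j.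

Lemma map_generic_mx (U : 'M[C]_(m, n)) :
  map_mx (meval (fun k => mxvec U 0 k)) generic_mx = U.
Proof. by apply/matrixP => i j; rewrite !mxE; apply: mxevalX. Qed.

End Substitution.

(** Contains a nonempty principal open subset; this is equivalent to containing
    a nonempty Zariski open subset. *)
Definition generic (C : closedFieldType) m n (G : set 'M[C]_(m, n)) :=
  exists p, (exists U, mxeval p U != 0) /\ forall U, mxeval p U != 0 -> G U.

Section Mxeval.
Variables (C : closedFieldType) (m n : nat).
Implicit Types (U V x : 'M[C]_(m, n)) (p q : {mpoly C[m * n]}).

Lemma mxevalD p q U : mxeval (p + q) U = mxeval p U + mxeval q U.
Proof. exact: mevalD. Qed.
Lemma mxevalN p U : mxeval (- p) U = - mxeval p U.
Proof. exact: mevalN. Qed.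
Lemma mxevalM p q U : mxeval (p * q) U = mxeval p U * mxeval q U.
Proof. exact: mevalM. Qed.
Lemma mxevalC a U : mxeval a%:MP U = a.
Proof. exact: mevalC. Qed.
Lemma mxeval1 U : mxeval 1 U = 1.
Proof. exact: meval1. Qed.
Lemma mxevalZ a p U : mxeval (a *: p) U = a * mxeval p U.
Proof. exact: mevalZ. Qed.
Lemma mxeval_sum I (r : seq I) P (F : I -> {mpoly C[m * n]}) U :
  mxeval (\sum_(i <- r | P i) F i) U = \sum_(i <- r | P i) mxeval (F i) U.
Proof. exact: (raddf_sum (meval (fun k => mxvec U 0 k))). Qed.
Lemma mxeval_prod I (r : seq I) P (F : I -> {mpoly C[m * n]}) U :
  mxeval (\prod_(i <- r | P i) F i) U = \prod_(i <- r | P i) mxeval (F i) U.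
Proof. exact: (rmorph_prod (meval (fun k => mxvec U 0 k))). Qed.

Definition curve_at t (g : 'M[{poly C}]_(m, n)) : 'M[C]_(m, n) :=
  map_mx (horner_eval t) g.

Lemma mxsubst_curve (g : 'M[{poly C}]_(m, n)) p t :
  (mxsubst polyC g p).[t] = mxeval p (curve_at t g).
Proof.
rewrite -[LHS]/(horner_eval t _).
by apply: (@mxsubst_eval C _ m n (@polyC C) g (horner_eval t)) => a; apply: hornerC.
Qed.

(** The chain rule.  Both sides are derivations in p with values in univariate
    polynomials, and they agree on the variables. *)
Lemma deriv_mxsubst (g : 'M[{poly C}]_(m, n)) p :
  (mxsubst polyC g p)^`() =
  \sum_k mxsubst polyC g (mderiv k p) * (mxvec g 0 k)^`().
Proof.
pose D p := \sum_k mxsubst polyC g (mderiv k p) * (mxvec g 0 k)^`().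
rewrite -/(D p).
have DD q1 q2 : D (q1 + q2) = D q1 + D q2.
  by rewrite /D -big_split; apply: eq_bigr => k _; rewrite mderivD rmorphD mulrDl.
have DM q1 q2 : D (q1 * q2) = D q1 * mxsubst polyC g q2 + mxsubst polyC g q1 * D q2.
  rewrite /D mulr_suml mulr_sumr -big_split; apply: eq_bigr => k _ /=.
  by rewrite mderivM rmorphD !rmorphM /=; ring.
have DC a : D a%:MP = 0.
  by rewrite /D big1 // => k _; rewrite mderivC rmorph0 mul0r.
have DX i : D 'X_i = (mxvec g 0 i)^`().
  rewrite /D (bigD1 i) //= mderivX mnm1E eqxx scale1r.
  have -> : (U_(i) - U_(i) = 0)%MM by apply/mnmP => l; rewrite mnmBE subnn mnm0E.
  rewrite mpolyX0 rmorph1 mul1r.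
  rewrite big1 ?addr0 // => k ki.
  by rewrite mderivX mnm1E eq_sym (negPf ki) scale0r rmorph0 mul0r.
have P1 q1 q2 : (mxsubst polyC g q1)^`() = D q1 -> (mxsubst polyC g q2)^`() = D q2 ->
    (mxsubst polyC g (q1 * q2))^`() = D (q1 * q2).
  by move=> E1 E2; rewrite rmorphM derivM E1 E2 DM.
elim/mpolyind: p => [|c mm p _ _ IH].
  by rewrite rmorph0 deriv0 -(mpolyC0 _ C) DC.
rewrite rmorphD derivD IH DD; congr (_ + _).
rewrite -mul_mpolyC; apply: (P1); first by rewrite DC /mxsubst mmapC derivC.
rewrite mpolyXE_id; elim/big_ind: _ => [|q1 q2|i _].
- by rewrite rmorph1 derivC -(mpolyC1 _ C) DC.
- exact: P1.
- elim: (mm i) => [|e IHe]; first by rewrite expr0 rmorph1 derivC -(mpolyC1 _ C) DC.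
  by rewrite exprS; apply: (P1) => //; rewrite DX /mxsubst mmapX mmap1U.
Qed.

Lemma deriv_curve (g : 'M[{poly C}]_(m, n)) p t :
  (mxsubst polyC g p)^`().[t] =
  differential p (curve_at t g) (curve_at t (map_mx deriv g)).
Proof.
rewrite deriv_mxsubst horner_sum /differential.
rewrite pair_big /= (reindex _ (curry_mxvec_bij _ _)) /=.
apply: eq_bigr => -[i j] _ /=; rewrite hornerM mxsubst_curve mxvecE; congr (_ * _).
by rewrite !mxE.
Qed.

Lemma poly_fun0 (q : {poly C}) : (forall t, q.[t] = 0) -> q = 0.
Proof.
move=> q0; apply: contraTeq isT => /closed_nonrootP[t].
by rewrite rootE q0 eqxx.
Qed.

(** A polynomial vanishing on X vanishes along the curve, and so does its
    derivative, which the chain rule expresses by the velocity. *)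
Lemma curve_tangent (X : set 'M[C]_(m, n)) (g : 'M[{poly C}]_(m, n)) t :
  (forall s, X (curve_at s g)) ->
  tangent_space X (curve_at t g) (curve_at t (map_mx deriv g)).
Proof.
move=> gX p pX; rewrite -deriv_curve (poly_fun0 (q := mxsubst polyC g p)).
  by rewrite deriv0 horner0.
by move=> s; rewrite mxsubst_curve; apply: pX.
Qed.

Lemma genericI (G H : set 'M[C]_(m, n)) : generic G -> generic H -> generic (G `&` H).
Proof.
move=> [p [[U pU] pG]] [q [[V qV] qH]]; exists (p * q); split.
  have [t [pt qt]] := mpoly_line_neq0 pU qV.
  exists (U + t *: (V - U)); rewrite mxevalM /mxeval.
  set z := fun k => _ in pt qt.
  have E : (fun k => mxvec (U + t *: (V - U)) 0 k) =1 z.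
    by move=> k; rewrite linearD linearZ linearB /= !mxE.
  by rewrite !(meval_eq _ E) mulf_neq0.
move=> W; rewrite mxevalM mulf_eq0 negb_or => /andP[pW qW].
by split; [apply: pG|apply: qH].
Qed.

Lemma genericS (G H : set 'M[C]_(m, n)) : G `<=` H -> generic G -> generic H.
Proof. by move=> GH [p [pU pG]]; exists p; split=> // U /pG/GH. Qed.

Lemma genericT : generic [set: 'M[C]_(m, n)].
Proof. by exists 1; split=> //; exists 0; rewrite mxeval1 oner_neq0. Qed.

Lemma generic_forall (I : finType) (G : I -> set 'M[C]_(m, n)) :
  (forall i, generic (G i)) -> generic [set U | forall i, G i U].
Proof.
move=> gG; have : generic [set U | forall i, i \in enum I -> G i U].
  elim: (enum I) => [|i s IH]; first by apply: genericS genericT.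
  apply: genericS (genericI (gG i) IH) => U [GU sU] j.
  by rewrite inE => /orP[/eqP->|/sU].
by apply: genericS => U GU i; apply: GU; rewrite mem_enum.
Qed.

Lemma generic_neq0 (F : 'M[C]_(m, n) -> C) p :
  (forall U, mxeval p U = F U) -> (exists U, F U != 0) ->
  generic [set U | F U != 0].
Proof.
move=> pF [U FU]; exists p; split; first by exists U; rewrite pF.
by move=> V; rewrite pF.
Qed.

Lemma generic_preimage r c (L : 'M[C]_(m, n) -> 'M[C]_(r, c))
    (x : 'M[{mpoly C[m * n]}]_(r, c))
    (G : set 'M[C]_(r, c)) :
  (forall U, L U = map_mx (meval (fun k => mxvec U 0 k)) x) ->
  (forall y, exists U, L U = y) ->
  generic G -> generic [set U | G (L U)].
Proof.
move=> LE Lsurj [p [[y py] pG]].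
have pL U : mxeval (mxsubst (@mpolyC (m * n) C) x p) U = mxeval p (L U).
  rewrite LE; apply: (@mxsubst_eval C _ r c (@mpolyC (m * n) C) x
    (meval (fun k => mxvec U 0 k))) => a.
  exact: mevalC.
exists (mxsubst (@mpolyC (m * n) C) x p); split.
  by have [U Uy] := Lsurj y; exists U; rewrite pL Uy.
by move=> U; rewrite pL; apply: pG.
Qed.

End Mxeval.

(** * Critical points for a generic matrix *)

Section GenericRankOne.
Variable C : numClosedFieldType.

(** The conclusions about one cone: the number of critical points of rank one,
    and the fact that they avoid the coordinate hyperplanes. *)
Definition good_mx r c : set 'M[C]_(r, c) :=
  [set U | U != 0 /\ exists s : seq 'M[C]_(r, c),
     [/\ uniq s, size s = minn r c, forall x, x \in s <-> critical_rank1 U x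
       & forall x i j, x \in s -> x i j != 0]].

Lemma generic_natural r c (F : forall R : comNzRingType, 'M[R]_(r, c) -> R) :
  (forall (R R' : comNzRingType) (f : {rmorphism R -> R'}) U,
     f (F R U) = F R' (map_mx f U)) ->
  (exists U, F C U != 0) -> generic [set U | F C U != 0].
Proof.
move=> Fnat; apply: (@generic_neq0 C r c (F C) (F _ (generic_mx C r c))) => U.
rewrite -[in RHS](map_generic_mx U).
by have := Fnat _ _ (meval (fun k => mxvec U 0 k)) (generic_mx C r c).
Qed.

Lemma generic_good_le r c : (r.+1 <= c)%N -> generic (@good_mx r.+1 c).
Proof.
move=> rc.
have g0 : generic [set U : 'M[C]_(r.+1, c) | \det (gram U) != 0].
  apply: (@generic_natural _ _ (fun R U => \det (gram U))).
    by move=> R R' f U; rewrite -det_map_mx map_gram.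
  by exists (example_mx C rc xpredT xpredT); apply: det_gram_example.
have g1 : generic [set U : 'M[C]_(r.+1, c) | disc_test U != 0].
  apply: (@generic_natural _ _ (fun R U => disc_test U)).
    by move=> R R' f U; apply: rmorph_disc_test.
  by exists (example_mx C rc xpredT xpredT); apply: disc_test_example.
have g2 : generic [set U : 'M[C]_(r.+1, c) |
    forall i, mask_test (predC1 i) xpredT U != 0].
  apply: (@generic_forall _ _ _ _ (fun i => [set U | mask_test (predC1 i) xpredT U != 0])).
  move=> i; apply: (@generic_natural _ _ (fun R U => mask_test (predC1 i) xpredT U)).
    by move=> R R' f U; apply: rmorph_mask_test.
  by exists (example_mx C rc (predC1 i) xpredT); apply: mask_test_row_example.
have g3 : generic [set U : 'M[C]_(r.+1, c) |
    forall j, mask_test xpredT (predC1 j) U != 0].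
  apply: (@generic_forall _ _ _ _ (fun j => [set U | mask_test xpredT (predC1 j) U != 0])).
  move=> j; apply: (@generic_natural _ _ (fun R U => mask_test xpredT (predC1 j) U)).
    by move=> R R' f U; apply: rmorph_mask_test.
  by exists (example_mx C rc xpredT (predC1 j)); apply: mask_test_col_example.
apply: genericS (genericI (genericI g0 g1) (genericI g2 g3)).
move=> U [[/= d0 d1] [d2 d3]]; split.
  apply: contraNneq d0 => ->; rewrite /gram mul0mx det0 //.
have [s [us ss sc s0]] := critical_rank1_seq d0 d1 d2 d3.
by exists s; split=> //; rewrite ss (minn_idPl rc).
Qed.

Lemma generic_good r c : (0 < r)%N -> (0 < c)%N -> generic (@good_mx r c).
Proof.
case: r c => // r [//|c] _ _; have [rc|/ltnW cr] := leqP r.+1 c.+1.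
  exact: generic_good_le.
have := generic_good_le cr => gG.
have gT := @generic_preimage C r.+1 c.+1 c.+1 r.+1 trmx (generic_mx C r.+1 c.+1)^T _ _ _ gG.
apply: (genericS _ (gT _ _)) => [U /= [U0 [s [us ss sc s0]]]|U|y].
- split; first by apply: contraNneq U0 => ->; rewrite trmx0.
  exists [seq x^T | x <- s]; split.
  + by rewrite map_inj_uniq //; apply: trmx_inj.
  + by rewrite size_map ss minnC.
  + move=> x; rewrite -[x]trmxK (mem_map (@trmx_inj _ _ _)) sc.
    split=> /critical_rank1_tr; by rewrite ?trmxK.
  + by move=> x i j /mapP[y ys ->]; rewrite mxE s0.
- by rewrite -map_trmx map_generic_mx.
- by exists y^T; rewrite trmxK.
Qed.

End GenericRankOne.

(** * Dimension of parametrized varieties *)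

Section Degrees.
Variables (C : closedFieldType) (N : nat).
Implicit Types p q : {mpoly C[N]}.

Lemma msizeM_leq p q a b :
  (msize p <= a.+1)%N -> (msize q <= b.+1)%N -> (msize (p * q) <= (a + b).+1)%N.
Proof.
move=> pa qb; have [->|p0] := eqVneq p 0; first by rewrite mul0r msize0.
have [->|q0] := eqVneq q 0; first by rewrite mulr0 msize0.
rewrite msizeM //; move: (msize p) (msize q) pa qb => k l; lia.
Qed.

Lemma msizeX_leq p a e : (msize p <= a.+1)%N -> (msize (p ^+ e) <= (a * e).+1)%N.
Proof.
move=> pa; elim: e => [|e IHe]; first by rewrite expr0 msize1.
by rewrite exprS mulnS msizeM_leq.
Qed.

Lemma msize_prod_leq (I : finType) (F : I -> {mpoly C[N]}) (d : I -> nat) :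
  (forall i, msize (F i) <= (d i).+1)%N ->
  (msize (\prod_i F i) <= (\sum_i d i).+1)%N.
Proof.
move=> Fd; elim/big_rec2: _ => [|i p e _ IH]; first by rewrite msize1.
exact: msizeM_leq.
Qed.

Lemma msize_sum_leq (I : Type) (r : seq I) (F : I -> {mpoly C[N]}) a :
  (forall i, msize (F i) <= a)%N -> (msize (\sum_(i <- r) F i) <= a)%N.
Proof.
move=> Fa; elim/big_ind: _ => [|p q pa qa|//]; first by rewrite msize0.
by rewrite (leq_trans (msizeD_le _ _)) // geq_max pa.
Qed.

Lemma card_bmultinom_leq E : (#|{: 'X_{1..N < E.+1}}| <= E.+1 ^ N)%N.
Proof.
rewrite -[E.+1 in leqRHS](card_ord E.+1) -[N in leqRHS]card_ord -card_ffun.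
pose h (a : 'X_{1..N < E.+1}) := [ffun i : 'I_N => (inord (bmnm a i) : 'I_E.+1)].
apply: (@leq_card _ _ h) => a b /ffunP ab; apply/val_inj/mnmP => i.
have lt (x : 'X_{1..N < E.+1}) : (bmnm x i < E.+1)%N.
  by apply: leq_ltn_trans (bmdeg x); rewrite mdegE (bigD1 i) //= leq_addr.
by have := ab i; rewrite !ffunE => /(congr1 val) /=; rewrite !inordK ?lt.
Qed.

(** The polynomials of degree at most E span a space of dimension at most
    (E + 1)^N, the number of exponent vectors bounded by E. *)
Lemma mpoly_dependent (I : finType) (b : I -> {mpoly C[N]}) E :
  (forall i, msize (b i) <= E.+1)%N -> (E.+1 ^ N < #|I|)%N ->
  exists c : I -> C, (exists i, c i != 0) /\ \sum_i c i *: b i = 0.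
Proof.
move=> bE ltI; pose T := 'X_{1..N < E.+1}.
pose A : 'M[C]_(#|I|, #|{: T}|) := \matrix_(i, k) (b (enum_val i))@_(bmnm (enum_val k)).
have : kermx A != 0.
  rewrite kermx_eq0 /row_free neq_ltn; apply/orP; left.
  apply: leq_ltn_trans (rank_leq_col A) _.
  exact: leq_ltn_trans (card_bmultinom_leq E) _.
rewrite -nz_row_eq0; set v := nz_row _ => v0.
have vA : v *m A = 0 by apply/sub_kermxP/nz_row_sub.
have [i vi] : exists i, v 0 i != 0.
  apply/existsP; apply: contraNT v0; rewrite negb_exists => /forallP z.
  by apply/eqP/rowP => i; rewrite [RHS]mxE; apply/eqP; have := z i; rewrite negbK.
exists (fun j => v 0 (enum_rank j)); split; first by exists (enum_val i); rewrite enum_valK.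
apply/mpolyP => mm; rewrite mcoeff0 raddf_sum /=.
have [lt|ge] := ltnP (mdeg mm) E.+1; last first.
  rewrite big1 // => j _; rewrite mcoeffZ memN_msupp_eq0 ?mulr0 //.
  by apply: msize_mdeg_ge; apply: leq_trans ge.
have := congr1 (fun M : 'rV_ _ => M 0 (enum_rank (BMultinom lt))) vA.
rewrite mxE [RHS]mxE; apply: etrans.
rewrite [RHS](reindex enum_rank) /=; last by apply: onW_bij; apply: enum_rank_bij.
by apply: eq_bigr => j _; rewrite mcoeffZ mxE !enum_rankK.
Qed.

End Degrees.

Lemma msize_mxsubst (C : closedFieldType) m n N (g : 'M[{mpoly C[N]}]_(m, n))
    (p : {mpoly C[m * n]}) K s :
  (msize p <= K.+1)%N -> (forall i j, msize (g i j) <= s.+1)%N ->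
  (msize (mxsubst (@mpolyC N C) g p) <= (s * K).+1)%N.
Proof.
move=> pK gs; rewrite /mxsubst (mmapE _ pK); apply: msize_sum_leq => a.
rewrite -[(s * K).+1]/((0 + s * K).+1); apply: msizeM_leq.
  by rewrite msizeC; case: (_ != 0).
apply: leq_trans (msize_prod_leq (d := fun i => (s * (bmnm a i))%N) _) _.
  move=> i; apply: msizeX_leq; case/mxvec_indexP: i => i j; rewrite mxvecE; exact: gs.
by rewrite ltnS -big_distrr /= leq_mul2l -mdegE -ltnS bmdeg orbT.
Qed.

(** With D as given, D^(d+1) exceeds the number of monomials in d variables of
    degree at most [s * (d.+1 * del * D)], which is at most a constant times
    D^d. *)
Lemma dimension_count d del s D :
  D = (((d.+1 * del * s).+1) ^ d).+1 ->
  ((s * (d.+1 * del * D)).+1 ^ d < D ^ d.+1)%N.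
Proof.
move=> DE; set a := (d.+1 * del * s)%N in DE.
have -> : (s * (d.+1 * del * D) = a * D)%N by rewrite /a; ring.
apply: (@leq_ltn_trans ((a.+1 * D) ^ d)%N).
  have D0 : (0 < D)%N by rewrite DE.
  have le1 : ((a * D).+1 <= a.+1 * D)%N by rewrite mulSn addnC -addn1 leq_add2l.
  by case: (d) => [|d']; rewrite ?expn0 // leq_exp2r.
by rewrite expnMn expnS ltn_pmul2r ?expn_gt0 DE.
Qed.

Section Irreducible.
Variables (C : closedFieldType) (m n : nat).
Implicit Types (X F A B : set 'M[C]_(m, n)) (p q : {mpoly C[m * n]}).

Definition vanishes p F := forall y, F y -> mxeval p y = 0.

(** The vanishing ideal of an irreducible set is prime. *)
Lemma irreducible_mul F p q : zariski_irreducible F ->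
  vanishes (p * q) F -> vanishes p F \/ vanishes q F.
Proof.
move=> [_ irr] pq; pose Z q := zero_locus [set q].
have ZE r y : Z r y <-> mxeval r y = 0 by split=> [|ry q' ->//]; apply.
have := irr (Z p) (Z q); case.
- by exists [set p].
- by exists [set q].
- move=> y /pq; rewrite mxevalM => /eqP; rewrite mulf_eq0.
  by move=> /orP[]/eqP H; [left|right]; apply/ZE.
- by move=> H; left=> y /H/ZE.
- by move=> H; right=> y /H/ZE.
Qed.

Lemma closed_separation A B : zariski_closed A -> ~ (B `<=` A) ->
  exists p, vanishes p A /\ exists2 y, B y & mxeval p y != 0.
Proof.
move=> [I ->] /existsNP[y /not_implyP[By nAy]].
have /existsNP[p /not_implyP[Ip /eqP py]] := nAy.
by exists p; split=> [z|]; [apply|exists y].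
Qed.

(** Induction on k: the new family consists of the products of the old one with
    the powers of f_k below D.  In a relation that vanishes on F_(k+1), let j be
    the least power of f_k that occurs.  Since f_k does not vanish on the
    irreducible set F_(k+1), the relation may be divided by f_k^j; restricting
    it to F_k, where f_k vanishes, leaves the coefficient of f_k^j, which is a
    relation between the members of the old family. *)
Lemma independent_family (F : nat -> set 'M[C]_(m, n))
    (f : nat -> {mpoly C[m * n]}) del D k :
  (forall i, (i <= k)%N -> zariski_irreducible (F i)) ->
  (forall i, (i < k)%N -> F i `<=` F i.+1) ->
  (forall i, (i < k)%N -> [/\ vanishes (f i) (F i),
     exists2 y, F i.+1 y & mxeval (f i) y != 0 & (msize (f i) <= del.+1)%N]) ->
  exists (I : finType) (b : I -> {mpoly C[m * n]}), [/\ #|I| = (D ^ k)%N,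
    forall i, (msize (b i) <= (k * del * D).+1)%N &
    forall c : I -> C, vanishes (\sum_i c i *: b i) (F k) -> forall i, c i = 0].
Proof.
elim: k => [|k IHk] irr sub sep.
  exists unit, (fun=> 1); split=> [|_|c c0 []]; rewrite ?card_unit ?msize1 //.
  have [[y Fy] _] := irr 0%N (leqnn _).
  have := c0 y Fy; rewrite (bigD1 tt) //= big1 ?addr0 => [|[]//].
  by rewrite mxevalZ mxeval1 mulr1.
have [||i ik|I [b [cI bs bI]]] := IHk.
- by move=> i /leqW; apply: irr.
- by move=> i /leqW; apply: sub.
- by apply: sep; apply: leqW.
have [fF [y0 Fy0 fy0] fs] := sep k (leqnn _).
exists (I * 'I_D)%type, (fun ij : I * 'I_D => b ij.1 * f k ^+ ij.2); split.
- by rewrite card_prod cI card_ord expnSr.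
- move=> [i j] /=; apply: leq_trans (msizeM_leq (bs i) (msizeX_leq j fs)) _.
  by have := ltn_ord j; nia.
move=> c cF; pose G j := \sum_i c (i, j) *: b i.
have sumE : \sum_ij c ij *: (b ij.1 * f k ^+ ij.2) = \sum_j f k ^+ (val j) * G j.
  under [RHS]eq_bigr do rewrite mulr_sumr.
  rewrite exchange_big pair_bigA; apply: eq_bigr => -[i j] _ /=.
  by rewrite mulrC scalerAr.
suff all0 N : forall j : 'I_D, (j < N)%N -> forall i, c (i, j) = 0.
  by move=> [i j]; apply: (all0 D).
elim: N => // N IHN j; rewrite ltnS leq_eqVlt => /orP[/eqP jN|]; last exact: IHN.
pose H := \sum_(l : 'I_D | (j < l)%N) f k ^+ (l - j.+1) * G l.
have sumE' : \sum_j f k ^+ (val j) * G j = f k ^+ j * (G j + f k * H).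
  rewrite mulrDr (bigD1 j) //=; congr (_ + _).
  rewrite mulrA -exprSr mulr_sumr [RHS]big_mkcond [LHS]big_mkcond /=.
  apply: eq_bigr => l _; rewrite -val_eqE; case: ltngtP => //= lj.
    by rewrite mulrA -exprD subnKC.
  by rewrite /G big1 ?mulr0 // => i _; rewrite IHN ?scale0r // -jN.
apply: bI => y Fy; move: cF; rewrite sumE sumE' => cF.
have [E|E] := irreducible_mul (irr k.+1 (leqnn _)) cF.
  have := E y0 Fy0; rewrite /mxeval rmorphXn /= => /eqP.
  by rewrite expf_eq0 -/(mxeval _ _) (negPf fy0) andbF.
have := E y (sub k (leqnn _) y Fy).
by rewrite mxevalD mxevalM (fF y Fy) mul0r addr0.
Qed.

End Irreducible.

Section LocalDimension.
Variables (C : closedFieldType) (m n d : nat).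
Variables (phi : 'M[{mpoly C[d]}]_(m, n)) (X : set 'M[C]_(m, n)).
Local Notation at_ t := (map_mx (meval t) phi).

Lemma mxsubst_phi p t :
  (mxsubst (@mpolyC d C) phi p).@[t] = mxeval p (at_ t).
Proof.
by apply: (@mxsubst_eval C _ m n (@mpolyC d C) phi (meval t)) => a; apply: mevalC.
Qed.

(** A relation that holds on the image of the parametrization becomes, after
    multiplication by g, a relation on X; on the members of the chain, which
    contain x, the factor g can be cancelled. *)
Lemma chain_length_leq x g e F :
  (forall y, X y -> mxeval g y != 0 -> exists t, y = at_ t) ->
  mxeval g x != 0 -> irreducible_chain X x e F -> (e <= d)%N.
Proof.
move=> Xphi gx [Fi Fs]; rewrite leqNgt; apply/negP => de.
have Firr i : (i <= d.+1)%N -> zariski_irreducible (F i).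
  by move=> id; have [] := Fi i (leq_trans id de).
have /choice[f fP] i : exists p, (i < d.+1)%N -> vanishes p (F i) /\
    exists2 y, F i.+1 y & mxeval p y != 0.
  have [id|_] := ltnP i d.+1; last by exists 0.
  have ie : (i < e)%N by apply: leq_trans de.
  have [Fc _ _ _] := Fi i (ltnW ie); have [_ FiF] := Fs i ie.
  by have [p pP] := closed_separation Fc FiF; exists p.
pose del := \max_(i < d.+1) msize (f i).
pose s := \max_(ij : 'I_m * 'I_n) msize (phi ij.1 ij.2).
pose D := ((((d.+1 * del * s).+1) ^ d).+1)%N.
have [||i id|I [b [cI bs bI]]] := @independent_family C m n F f del D d.+1.
- exact: Firr.
- by move=> i id; have [] := Fs i (leq_trans id de).
- have [f0 f1] := fP i id; split=> //; apply: leqW.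
  exact: (leq_bigmax_cond (F := fun i : 'I_d.+1 => msize (f i)) (Ordinal id)).
have [||c [[i ci] c0]] := @mpoly_dependent C d I
    (fun i => mxsubst (@mpolyC d C) phi (b i)) (s * (d.+1 * del * D)) _ _.
- move=> i; apply: msize_mxsubst (bs i) _ => k l; apply: leqW.
  exact: (leq_bigmax_cond (F := fun ij : 'I_m * 'I_n => msize (phi ij.1 ij.2)) (k, l)).
- by rewrite cI; apply: dimension_count.
case/eqP: ci; apply: bI i => y Fy.
set q := \sum_i _.
have [Fc _ _ FX] := Fi d.+1 de.
have gqX : vanishes (g * q) (F d.+1).
  move=> z Fz; rewrite mxevalM; have [->|gz] := eqVneq (mxeval g z) 0.
    by rewrite mul0r.
  have [t ->] := Xphi z (FX z Fz) gz.
  suff -> : mxeval q (at_ t) = 0 by rewrite mulr0.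
  have := congr1 (meval t) c0; rewrite meval0 raddf_sum /= => E.
  rewrite -[RHS]E /q mxeval_sum; apply: eq_bigr => i _.
  by rewrite mxevalZ mevalZ mxsubst_phi.
have [E|] := irreducible_mul (Firr _ (leqnn _)) gqX; last exact.
have [_ _ Fx _] := Fi d.+1 de.
by move: gx; rewrite (E x Fx) eqxx.
Qed.

(** A set of parameters that contains the line through any two of its points is
    irreducible, and so is the closure of its image. *)
Lemma zclosure_irreducible (A : set ('I_d -> C)) t0 :
  A t0 ->
  (forall t t' s, A t -> A t' -> A (fun k => t k + s * (t' k - t k))) ->
  let F := zero_locus (vanishing_ideal [set at_ t | t in A]) in
  [/\ zariski_closed F, zariski_irreducible F, forall t, A t -> F (at_ t) &
     forall Z, zariski_closed Z -> (forall t, A t -> Z (at_ t)) -> F `<=` Z].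
Proof.
move=> At0 Aline F.
have FA t : A t -> F (at_ t) by move=> At p; apply; exists t.
have Fmin Z : zariski_closed Z -> (forall t, A t -> Z (at_ t)) -> F `<=` Z.
  move=> [I ->] AZ y Fy p Ip; apply: Fy => _ [t At <-]; exact: AZ.
split=> //; first by exists (vanishing_ideal [set at_ t | t in A]).
split=> [|Z1 Z2 c1 c2 FZ]; first by exists (at_ t0); apply: FA.
have sep Z : zariski_closed Z -> ~ F `<=` Z ->
    exists p, vanishes p Z /\ exists2 t, A t & mxeval p (at_ t) != 0.
  move=> cZ nFZ; have /existsNP[t /not_implyP[At nZ]] : ~ forall t, A t -> Z (at_ t).
    by move=> AZ; apply: nFZ; apply: Fmin.
  have [|p [pZ [_ -> pt]]] := @closed_separation C m n Z [set at_ t] cZ.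
    by move=> H; apply: nZ; apply: H.
  by exists p; split=> //; exists t.
have [|n1] := pselect (F `<=` Z1); first by left.
have [|n2] := pselect (F `<=` Z2); first by right.
have [p [pZ [t At pt]]] := sep _ c1 n1.
have [q [qZ [t' At' qt]]] := sep _ c2 n2.
rewrite -mxsubst_phi in pt; rewrite -mxsubst_phi in qt.
have [s /= [ps qs]] := mpoly_line_neq0 pt qt.
rewrite !mxsubst_phi in ps qs.
have /FZ[zz|zz] := FA _ (Aline _ _ s At At').
  by move: ps; rewrite pZ ?eqxx.
by move: qs; rewrite qZ ?eqxx.
Qed.

(** The i-th member of the chain is the closure of the image of the parameters
    that agree with t0 from the i-th coordinate on.  The hypothesis on
    separating polynomials makes the inclusions strict. *)
Lemma chain_exists (t0 : 'I_d -> C) :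
  zariski_closed X -> (forall t, X (at_ t)) ->
  (forall i : 'I_d, exists p, (forall t, t i = t0 i -> mxeval p (at_ t) = 0) /\
     exists t, (forall k : 'I_d, (i < k)%N -> t k = t0 k) /\ mxeval p (at_ t) != 0) ->
  exists F, irreducible_chain X (at_ t0) d F.
Proof.
move=> Xc Xphi sep.
pose A (i : nat) := [set t : 'I_d -> C | forall k : 'I_d, (i <= k)%N -> t k = t0 k].
have At0 i : A i t0 by [].
have Aline i t t' s : A i t -> A i t' -> A i (fun k => t k + s * (t' k - t k)).
  by move=> At At' k ik; rewrite At // At' // subrr mulr0 addr0.
pose F i := zero_locus (vanishing_ideal [set at_ t | t in A i]).
have FP i := zclosure_irreducible (At0 i) (Aline i).
exists F; split=> [i id|i id].
  by have [Fc Fi FA Fm] := FP i; split=> //; [apply: FA|apply: Fm].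
have [_ _ _ Fm] := FP i; have [Fc' _ FA' _] := FP i.+1; split.
  by apply: Fm => // t At; apply: FA' => k ik; apply: At; apply: ltnW.
have [p [p0 [t [tk pt]]]] := sep (Ordinal id).
move=> FF; move: pt; apply/negP; rewrite negbK; apply/eqP.
have /FF Ft : F i.+1 (at_ t) by apply: FA' => k ik; apply: tk.
by apply: Ft => _ [t' At' <-]; apply: p0; apply: At'.
Qed.

End LocalDimension.

(** * Tangent vectors *)

Section Tangent.
Variables (C : closedFieldType) (m n : nat).
Implicit Types (X : set 'M[C]_(m, n)) (x V W : 'M[C]_(m, n)) (p q : {mpoly C[m * n]}).

(** Curves of degree two are enough: [(u + s *: a) *m (v + s *: b)] is one. *)
Definition parabola x V W : 'M[{poly C}]_(m, n) :=
  \matrix_(i, j) ((x i j)%:P + 'X * (V i j)%:P + 'X^2 * (W i j)%:P).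

Lemma parabola_at s x V W : curve_at s (parabola x V W) = x + s *: V + s ^+ 2 *: W.
Proof.
by apply/matrixP => i j; rewrite !mxE /= /horner_eval !hornerE.
Qed.

Lemma deriv_parabola x V W : curve_at 0 (map_mx deriv (parabola x V W)) = V.
Proof.
apply/matrixP => i j; rewrite !mxE /= /horner_eval !derivE !hornerE.
by rewrite /= !addr0.
Qed.

Lemma parabola0 x V W : curve_at 0 (parabola x V W) = x.
Proof. by rewrite parabola_at expr0n !scale0r !addr0. Qed.

Lemma parabola_tangent X x V W :
  (forall s, X (x + s *: V + s ^+ 2 *: W)) -> tangent_space X x V.
Proof.
move=> XV; have := @curve_tangent C m n X (parabola x V W) 0.
by rewrite parabola0 deriv_parabola; apply=> s; rewrite parabola_at.
Qed.

Lemma differential_parabola p x V :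
  differential p x V = (mxsubst polyC (parabola x V 0) p)^`().[0].
Proof. by rewrite deriv_curve parabola0 deriv_parabola. Qed.

(** The differential at x in direction V is the derivative at 0 of a univariate
    polynomial, so it obeys the rules of univariate differentiation. *)
Lemma differentialM p q x V :
  differential (p * q) x V =
  differential p x V * mxeval q x + mxeval p x * differential q x V.
Proof.
rewrite !differential_parabola rmorphM derivM hornerD !hornerM.
by rewrite !mxsubst_curve parabola0.
Qed.

Lemma differentialB p q x V :
  differential (p - q) x V = differential p x V - differential q x V.
Proof. by rewrite !differential_parabola rmorphB derivB hornerD hornerN. Qed.

Lemma differential_coord i j x V : differential (coord_poly C i j) x V = V i j.
Proof.
rewrite differential_parabola mxsubst_coord mxE !derivE !hornerE.
by rewrite /= !addr0.
Qed.

End Tangent.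

(** * Matrices supported on a rectangle *)

Section Extension.
Variables (R : comNzRingType) (m n r c : nat).
Variables (f : 'I_r -> 'I_m) (g : 'I_c -> 'I_n).
Hypotheses (f_inj : injective f) (g_inj : injective g).

Definition select_mx p q (h : 'I_p -> 'I_q) : 'M[R]_(p, q) :=
  \matrix_(k, i) (h k == i)%:R.

Definition ext_mx (y : 'M[R]_(r, c)) : 'M[R]_(m, n) :=
  (select_mx f)^T *m y *m select_mx g.

Definition res_mx (x : 'M[R]_(m, n)) : 'M[R]_(r, c) :=
  select_mx f *m x *m (select_mx g)^T.

Lemma res_mxE x k l : res_mx x k l = x (f k) (g l).
Proof.
rewrite mxE (bigD1 (g l)) //= big1 => [|j /negPf jl].
  rewrite !mxE eqxx mulr1 addr0 (bigD1 (f k)) //= big1 => [|i /negPf ik].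
    by rewrite !mxE eqxx mul1r addr0.
  by rewrite !mxE eq_sym ik mul0r.
by rewrite !mxE eq_sym jl mulr0.
Qed.

Lemma select_mulmx_tr p q (h : 'I_p -> 'I_q) :
  injective h -> select_mx h *m (select_mx h)^T = 1%:M.
Proof.
move=> h_inj; apply/matrixP => k l; rewrite !mxE (bigD1 (h k)) //=.
rewrite big1 => [|j /negPf jl]; first by rewrite !mxE eqxx mul1r addr0 (inj_eq h_inj) eq_sym.
by rewrite !mxE eq_sym jl mul0r.
Qed.

Lemma ext_mxK : cancel ext_mx res_mx.
Proof.
move=> y; rewrite /res_mx /ext_mx !mulmxA select_mulmx_tr // mul1mx.
by rewrite -mulmxA select_mulmx_tr // mulmx1.
Qed.

Lemma ext_mxE y k l : ext_mx y (f k) (g l) = y k l.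
Proof. by rewrite -res_mxE ext_mxK. Qed.

Lemma ext_mx_out y i j : (i \notin codom f) || (j \notin codom g) -> ext_mx y i j = 0.
Proof.
case/orP=> [iN|jN].
  rewrite /ext_mx -mulmxA mxE big1 // => k _; rewrite !mxE.
  by case: eqP iN => [<-|_ _]; rewrite ?codom_f ?mul0r.
rewrite mxE big1 // => k _; rewrite [select_mx _ _ _]mxE.
by case: eqP jN => [<-|_ _]; rewrite ?codom_f ?mulr0.
Qed.

Lemma res_mxK (x : 'M[R]_(m, n)) :
  (forall i j, (i \notin codom f) || (j \notin codom g) -> x i j = 0) ->
  ext_mx (res_mx x) = x.
Proof.
move=> x0; apply/matrixP => i j.
have [/codomP[k ->]|iN] := boolP (i \in codom f); last first.
  by rewrite x0 ?iN // ext_mx_out ?iN.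
have [/codomP[l ->]|jN] := boolP (j \in codom g); last first.
  by rewrite x0 ?jN ?orbT // ext_mx_out ?jN ?orbT.
by rewrite ext_mxE res_mxE.
Qed.

Lemma ext_mxD y z : ext_mx (y + z) = ext_mx y + ext_mx z.
Proof. by rewrite /ext_mx mulmxDr mulmxDl. Qed.

Lemma ext_mxZ a y : ext_mx (a *: y) = a *: ext_mx y.
Proof. by rewrite /ext_mx -scalemxAr -scalemxAl. Qed.

Lemma ext_mx_mul k (u : 'M_(r, k)) (v : 'M_(k, c)) :
  ext_mx (u *m v) = ((select_mx f)^T *m u) *m (v *m select_mx g).
Proof. by rewrite /ext_mx !mulmxA. Qed.

Lemma res_mx_mul k (u : 'M_(m, k)) (v : 'M_(k, n)) :
  res_mx (u *m v) = (select_mx f *m u) *m (v *m (select_mx g)^T).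
Proof. by rewrite /res_mx !mulmxA. Qed.

End Extension.

Lemma map_ext_mx (R R' : comNzRingType) (h : {rmorphism R -> R'}) m n r c
    (f : 'I_r -> 'I_m) (g : 'I_c -> 'I_n) y :
  map_mx h (ext_mx f g y) = ext_mx f g (map_mx h y).
Proof.
have mapS p q (k : 'I_p -> 'I_q) : map_mx h (select_mx R k) = select_mx R' k.
  by apply/matrixP => i j; rewrite !mxE rmorph_nat.
by rewrite /ext_mx !map_mxM -map_trmx !mapS.
Qed.

Lemma frobenius_ext (C : closedFieldType) m n r c (f : 'I_r -> 'I_m)
    (g : 'I_c -> 'I_n) (D : 'M[C]_(m, n)) y :
  frobenius_form D (ext_mx f g y) = frobenius_form (res_mx f g D) y.
Proof.
rewrite /frobenius_form /ext_mx /res_mx !trmx_mul trmxK -!mulmxA.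
by rewrite [RHS]mxtrace_mulC -!mulmxA.
Qed.

Lemma frobenius_segre (C : closedFieldType) r c (D : 'M[C]_(r, c)) (u : 'cV_r) (v : 'rV_c) :
  (forall a b, frobenius_form D (a *m v + u *m b) = 0) <->
  D *m v^T = 0 /\ u^T *m D = 0.
Proof.
have E (a : 'cV_r) (b : 'rV_c) : frobenius_form D (a *m v + u *m b) =
    \tr (a^T *m (D *m v^T)) + \tr ((u^T *m D) *m b^T).
  rewrite /frobenius_form linearD mulmxDr linearD /= !trmx_mul.
  by rewrite -[in RHS](mulmxA u^T) ![in RHS](mxtrace_mulC _ (D *m _)) -!mulmxA.
split=> [D0|[D1 D2] a b]; last by rewrite E D1 D2 mulmx0 mul0mx !linear0 addr0.
split.
  apply/colP => k; rewrite [RHS]mxE -(D0 (delta_mx k 0) 0) E.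
  by rewrite trmx0 mulmx0 linear0 addr0 trmx_delta -rowE trace_mx11 [RHS]mxE.
apply/rowP => k; rewrite [RHS]mxE -(D0 0 (delta_mx 0 k)) E.
by rewrite trmx0 mul0mx linear0 add0r trmx_delta -colE trace_mx11 [RHS]mxE.
Qed.

(** * The variety along one of its components *)

Lemma outer_mxE (R : pzSemiRingType) p q (u : 'cV[R]_p) (v : 'rV[R]_q) k l :
  (u *m v) k l = u k 0 * v 0 l.
Proof. by rewrite mxE big_ord1. Qed.

(** In this section X contains a cone over a Segre variety and agrees with it
    where the polynomial h does not vanish.  The normalization [u 0 0 = 1] is
    the choice of an affine chart. *)
Section SegreChart.
Variables (C : closedFieldType) (m n r c : nat).
Variables (f : 'I_r.+1 -> 'I_m) (g : 'I_c.+1 -> 'I_n).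
Hypotheses (f_inj : injective f) (g_inj : injective g).
Variables (X : set 'M[C]_(m, n)) (h : {mpoly C[m * n]}).
Hypothesis X_closed : zariski_closed X.
Hypothesis X_segre : forall (u : 'cV_r.+1) (v : 'rV_c.+1), X (ext_mx f g (u *m v)).
Hypothesis X_local : forall y, X y -> mxeval h y != 0 ->
  exists (u : 'cV_r.+1) (v : 'rV_c.+1), y = ext_mx f g (u *m v).

Local Notation ext := (ext_mx f g).
Local Notation d := (r + c.+1)%N.

Lemma segre_tangent (u a : 'cV_r.+1) (v b : 'rV_c.+1) :
  tangent_space X (ext (u *m v)) (ext (a *m v + u *m b)).
Proof.
apply: (@parabola_tangent _ _ _ _ _ _ (ext (a *m b))) => s.
rewrite -!ext_mxZ -!ext_mxD.
suff -> : u *m v + s *: (a *m v + u *m b) + s ^+ 2 *: (a *m b) =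
  (u + s *: a) *m (v + s *: b) by apply: X_segre.
rewrite mulmxDl !mulmxDr -!scalemxAl -!scalemxAr scalerDr scalerA expr2.
by rewrite -!addrA; congr (_ + _); rewrite addrA [s *: _ + _ in LHS]addrC -addrA.
Qed.

Variables (u : 'cV[C]_r.+1) (v : 'rV[C]_c.+1).
Local Notation x := (ext (u *m v)).
Hypotheses (u0 : u 0 0 = 1) (v0 : v 0 0 != 0) (hx : mxeval h x != 0).

(** Multiplied by h, an equation of the cone becomes an equation of X, and
    h(x) is a nonzero factor of its differential. *)
Lemma tangent_local p V : tangent_space X x V ->
  (forall (a : 'cV_r.+1) (b : 'rV_c.+1), mxeval p (ext (a *m b)) = 0) ->
  differential p x V = 0.
Proof.
move=> TV p0; have /TV : vanishing_ideal X (h * p).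
  move=> y Xy; rewrite mxevalM; have [->|/(X_local Xy)[a [b ->]]] := eqVneq (mxeval h y) 0.
    by rewrite mul0r.
  by rewrite p0 mulr0.
by rewrite differentialM p0 mulr0 add0r => /eqP; rewrite mulf_eq0 (negPf hx) => /eqP.
Qed.

(** The equations are the coordinates outside the rectangle and the minors
    x_00 x_kl - x_0l x_k0.  The differentials of the latter express V_kl by the
    entries of V in row 0 and column 0. *)
Lemma tangent_segre V : tangent_space X x V ->
  exists (a : 'cV_r.+1) (b : 'rV_c.+1), a 0 0 = 0 /\ V = ext (a *m v + u *m b).
Proof.
move=> TV; have VE : ext (res_mx f g V) = V.
  apply: res_mxK => // i j ij; rewrite -(differential_coord i j x).
  by apply: tangent_local => // a b; rewrite mxevalX ext_mx_out.
pose y := res_mx f g V.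
pose M k l := coord_poly C (f k) (g l).
have yE k l : y k l = y k 0 / v 0 0 * v 0 l + u k 0 * (y 0 l - y 0 0 / v 0 0 * v 0 l).
  have : differential (M 0 0 * M k l - M 0 l * M k 0) x V = 0.
    apply: tangent_local => // a b.
    rewrite mxevalD mxevalN !mxevalM !mxevalX !ext_mxE // !mxE !big_ord1; ring.
  rewrite differentialB !differentialM !differential_coord !mxevalX !ext_mxE //.
  rewrite -!(res_mxE f g V) -/y !outer_mxE u0 => E.
  apply: (mulfI v0); apply/eqP; rewrite -subr_eq0 -E; apply/eqP.
  by field.
exists (\col_k (y k 0 / v 0 0 - u k 0 * (y 0 0 / v 0 0))), (\row_l y 0 l); split.
  by rewrite mxE u0 mul1r subrr.
rewrite -VE -/y; congr (ext _); apply/matrixP => k l.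
rewrite [LHS]yE [RHS]mxE !outer_mxE !mxE; ring.
Qed.

Definition chart_col (t : 'I_d -> C) : 'cV[C]_r.+1 :=
  \col_k oapp (fun k' => t (lshift c.+1 k')) 1 (unlift ord0 k).
Definition chart_row (t : 'I_d -> C) : 'rV[C]_c.+1 := \row_l t (rshift r l).

(** The parameters are the entries of u other than the first, which is 1, and
    then the entries of v. *)
Definition segre_chart : 'M[{mpoly C[d]}]_(m, n) :=
  ext ((\col_k oapp (fun k' => 'X_(lshift c.+1 k')) 1 (unlift ord0 k)) *m
       (\row_l 'X_(rshift r l))).

Lemma segre_chartE t :
  map_mx (meval t) segre_chart = ext (chart_col t *m chart_row t).
Proof.
rewrite map_ext_mx map_mxM; congr (ext (_ *m _)).
  apply/colP => k; rewrite !mxE; case: unliftP => [k' _|_] /=; last exact: meval1.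
  exact: mevalXU.
by apply/rowP => l; rewrite !mxE; apply: mevalXU.
Qed.

Definition chart_pt (a : 'cV[C]_r.+1) (b : 'rV[C]_c.+1) (i : 'I_d) : C :=
  match fintype.split i with inl k => a (lift ord0 k) 0 | inr l => b 0 l end.

Lemma chart_col_pt (a : 'cV_r.+1) b : a 0 0 = 1 -> chart_col (chart_pt a b) = a.
Proof.
move=> a0; apply/colP => k; rewrite mxE; case: unliftP => [k' ->|->] /=; last by rewrite a0.
by rewrite /chart_pt (unsplitK (inl k')).
Qed.

Lemma chart_row_pt a b : chart_row (chart_pt a b) = b.
Proof. by apply/rowP => l; rewrite mxE /chart_pt (unsplitK (inr l)). Qed.

(** The entry x_00 = v_0 of a point in the chart is nonzero at x, and where it
    is nonzero the parameters can be read off: v is row 0, and u is column 0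
    divided by x_00.  The polynomials x_0l - v_l and x_k0 - u_k x_00 separate the
    flag of parameters. *)
Lemma segre_local_dimension : local_dimension X x d.
Proof.
split; last first.
  move=> e F; apply: (@chain_length_leq _ _ _ d segre_chart X x
    (h * coord_poly C (f 0) (g 0))).
    move=> y Xy; rewrite mxevalM mulf_eq0 negb_or mxevalX => /andP[hy].
    have [a [b ->]] := X_local Xy hy; rewrite ext_mxE // mxE big_ord1 => ab0.
    have a0 : a 0 0 != 0 by apply: contraNneq ab0 => ->; rewrite mul0r.
    exists (chart_pt ((a 0 0)^-1 *: a) (a 0 0 *: b)).
    rewrite segre_chartE chart_col_pt ?mxE ?mulVf // chart_row_pt.
    by rewrite -scalemxAl -scalemxAr scalerA mulVf // scale1r.
  by rewrite mxevalM mxevalX ext_mxE // outer_mxE u0 mul1r mulf_neq0.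
have <- : map_mx (meval (chart_pt u v)) segre_chart = x.
  by rewrite segre_chartE chart_col_pt // chart_row_pt.
apply: chain_exists => // [t|i]; first by rewrite segre_chartE; apply: X_segre.
pose t' j := chart_pt u v j + (j == i)%:R.
have t'E j : j != i -> t' j = chart_pt u v j by rewrite /t' => /negPf ->; rewrite addr0.
have t'gt (k : 'I_d) : (i < k)%N -> t' k = chart_pt u v k.
  by move=> ik; apply: t'E; rewrite -val_eqE gtn_eqF.
have colE t k l : ext (chart_col t *m chart_row t) (f k) (g l) =
    chart_col t k 0 * t (rshift r l).
  by rewrite ext_mxE // mxE big_ord1 [chart_row _ _ _]mxE.
have col0 t : chart_col t 0 0 = 1 by rewrite mxE unlift_none.
have colS t k : chart_col t (lift ord0 k) 0 = t (lshift c.+1 k) by rewrite mxE liftK.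
case: (split_ordP i) => [k ik|l il].
  pose p := coord_poly C (f (lift ord0 k)) (g 0)
    - (u (lift ord0 k) 0)%:MP * coord_poly C (f 0) (g 0).
  have E t : mxeval p (map_mx (meval t) segre_chart) =
      (t i - chart_pt u v i) * t (rshift r 0).
    rewrite segre_chartE mxevalD mxevalN mxevalM mxevalC !mxevalX !colE col0 colS.
    rewrite ik.
    by rewrite /chart_pt (unsplitK (inl k)); ring.
  exists p; split=> [t ti|]; first by rewrite E ti subrr mul0r.
  exists t'; split=> //; rewrite E {1}/t' eqxx addrAC subrr add0r mul1r t'E.
    by rewrite /chart_pt (unsplitK (inr 0)).
  by rewrite ik eq_rlshift.
exists (coord_poly C (f 0) (g l) - (v 0 l)%:MP).
have E t : mxeval (coord_poly C (f 0) (g l) - (v 0 l)%:MP) (map_mx (meval t) segre_chart) =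
    t i - chart_pt u v i.
  rewrite segre_chartE mxevalD mxevalN mxevalC !mxevalX !colE col0 mul1r il.
  by rewrite /chart_pt (unsplitK (inr l)).
split=> [t ti|]; first by rewrite E ti subrr.
by exists t'; split=> //; rewrite E /t' eqxx addrAC subrr add0r oner_eq0.
Qed.

(** Fixing the first entry of a to 0 makes this injective: [a *m v + u *m b]
    does not change when a multiple of u is added to a and the same multiple of
    v is subtracted from b. *)
Definition tangent_map (t : 'rV[C]_d) : 'M[C]_(m, n) :=
  ext ((\col_k oapp (fun k' => t 0 (lshift c.+1 k')) 0 (unlift ord0 k)) *m v
       + u *m (rsubmx t)).

Lemma tangent_map_linear : linear tangent_map.
Proof.
move=> s t t'; rewrite /tangent_map -ext_mxZ -ext_mxD; congr (ext _).
rewrite linearP /= mulmxDr -scalemxAr scalerDr addrACA; congr (_ + _).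
rewrite scalemxAl -mulmxDl; congr (_ *m _); apply/colP => k; rewrite !mxE.
by case: unliftP => [k' _|_] /=; rewrite ?mxE ?mulr0 ?addr0.
Qed.

HB.instance Definition _ :=
  GRing.isLinear.Build C 'rV[C]_d 'M[C]_(m, n) _ tangent_map tangent_map_linear.

Lemma tangent_map_inj t : tangent_map t = 0 -> t = 0.
Proof.
rewrite /tangent_map; set a := \col_k _; set b := rsubmx t => ab0.
have E k l : a k 0 * v 0 l + u k 0 * b 0 l = 0.
  have := congr1 (fun M : 'M_(m, n) => M (f k) (g l)) ab0.
  by rewrite ext_mxE // [RHS]mxE => <-; rewrite [RHS]mxE !outer_mxE.
have a0 : a 0 0 = 0 by rewrite mxE unlift_none.
have b0 l : b 0 l = 0 by have := E 0 l; rewrite a0 u0 mul0r mul1r add0r.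
have ak k : a k 0 = 0.
  by have /eqP := E k 0; rewrite b0 mulr0 addr0 mulf_eq0 (negPf v0) orbF => /eqP.
apply/rowP => i; rewrite [RHS]mxE; case: (split_ordP i) => [k ->|l ->].
  by have := ak (lift ord0 k); rewrite mxE liftK.
by have := b0 l; rewrite mxE.
Qed.

Lemma segre_smooth : smooth_point X x.
Proof.
split; first exact: X_segre.
exists (limg (linfun tangent_map)); split=> [V|].
  split=> [/memv_imgP[t _ ->]|/tangent_segre[a [b [a0 ->]]]].
    by rewrite lfunE /=; apply: segre_tangent.
  pose t : 'rV[C]_d := row_mx (\row_k a (lift ord0 k) 0) b.
  have -> : ext (a *m v + u *m b) = linfun tangent_map t.
    rewrite lfunE /= /tangent_map row_mxKr; congr (ext (_ *m _ + _)).
    apply/colP => k; rewrite mxE; case: unliftP => [k' ->|->] //=.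
    by rewrite row_mxEl mxE.
  exact: memv_img (memvf _).
rewrite limg_dim_eq; last first.
  apply/eqP; rewrite -subv0; apply/subvP => t; rewrite memv_cap memvf /= memv_ker lfunE /=.
  by move/eqP/tangent_map_inj ->; rewrite mem0v.
rewrite dimvf /dim /= mul1n; exact: segre_local_dimension.
Qed.

End SegreChart.

(** * Minimal covers *)

Section MinimalCovers.
Variables (m n : nat) (S : {set 'I_m * 'I_n}).
Implicit Types A B : {set 'I_m} * {set 'I_n}.

Lemma rect_patternE A i j :
  ((i, j) \in rect_pattern A) = (i \in A.1) || (j \in A.2).
Proof. by rewrite inE. Qed.

Lemma rect_cover A : S \subset rect_pattern A -> is_cover S (rect_pattern A).
Proof. by move=> SA; rewrite /is_cover SA; apply/existsP; exists A. Qed.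

Lemma MC_sub A : A \in MC S -> S \subset rect_pattern A.
Proof. by rewrite inE => /minsetp/andP[]. Qed.

Lemma MC_exists A : S \subset rect_pattern A ->
  exists2 B, B \in MC S & rect_pattern B \subset rect_pattern A.
Proof.
move=> /rect_cover/minset_exists[T minT TA].
have /andP[_ /existsP[B /eqP TB]] := minsetp minT.
by exists B; rewrite ?inE -TB.
Qed.

Hypothesis S_proper : S != [set: 'I_m * 'I_n]%SET.

(** As S is a proper subset, the complement of a point outside S is a
    rectangular cover; so the full pattern is not minimal. *)
Lemma MC_notin A : A \in MC S -> exists i j, i \notin A.1 /\ j \notin A.2.
Proof.
move=> AS; have [[[i j] ijA]|fullA] :
    (exists ij, ij \notin rect_pattern A) \/ forall ij, ij \in rect_pattern A.
- have [/forallP|] := boolP [forall ij, ij \in rect_pattern A]; first by right.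
  by rewrite negb_forall => /existsP; left.
- by exists i, j; apply/andP; rewrite -negb_or -rect_patternE.
have [[i j] ijS] : exists ij, ij \notin S.
  apply/existsP; apply: contraNT S_proper; rewrite negb_exists => /forallP all_S.
  by apply/eqP/setP => ij; rewrite inE; have := all_S ij; rewrite negbK.
pose B := (~: [set i], ~: [set j])%SET.
have BE k l : ((k, l) \in rect_pattern B) = ((k, l) != (i, j)).
  by rewrite rect_patternE !inE xpair_eqE negb_and.
have SB : S \subset rect_pattern B.
  by apply/fintype.subsetP => -[k l] klS; rewrite BE; apply: contraNneq ijS => <-.
move: (AS); rewrite inE => /minsetP[_ /(_ _ (rect_cover SB))].
have /[swap]/[apply] E : rect_pattern B \subset rect_pattern A.
  by apply/fintype.subsetP => ij _.
by have := fullA (i, j); rewrite -E BE eqxx.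
Qed.

Lemma MC_inj A B : A \in MC S -> B \in MC S ->
  rect_pattern A \subset rect_pattern B -> A = B.
Proof.
move=> AS BS AB; have [i0 [j0 [iB jB]]] := MC_notin BS.
have E : rect_pattern A = rect_pattern B.
  move: (BS); rewrite inE => /minsetP[_ minB]; apply: minB => //.
  exact/rect_cover/MC_sub.
have : (i0, j0) \notin rect_pattern A by rewrite E rect_patternE negb_or iB.
rewrite rect_patternE negb_or => /andP[iA jA].
case: A B E {AS BS AB} iA jA iB jB => [A1 A2] [B1 B2] E /= iA jA iB jB.
congr (_, _); apply/setP => k.
  have /setP/(_ (k, j0)) := E; rewrite !rect_patternE /=.
  by rewrite (negPf jA) (negPf jB) !orbF.
have /setP/(_ (i0, k)) := E; rewrite !rect_patternE /=.
by rewrite (negPf iA) (negPf iB).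
Qed.

End MinimalCovers.

(** The successor form provides the index 0 that the affine chart of the cone
    singles out. *)
Lemma index_set p (B : {set 'I_p}) i0 : i0 \notin B ->
  exists r (f : 'I_r.+1 -> 'I_p), [/\ injective f, forall i, (i \in codom f) = (i \notin B)
     & r.+1 = (p - #|B|)%N].
Proof.
move=> iB; have cB : #|~: B| = (p - #|B|)%N by rewrite cardsCs finset.setCK card_ord.
have : (0 < #|~: B|)%N by rewrite card_gt0; apply/set0Pn; exists i0; rewrite inE.
case E : #|~: B| => [//|r] _; exists r, (fun k => enum_val (cast_ord (esym E) k)).
split=> [k l /enum_val_inj/cast_ord_inj//|i|]; last by rewrite -E.
apply/codomP/idP => [[k ->]|iN]; first by have := enum_valP (cast_ord (esym E) k); rewrite inE.
have iC : i \in ~: B by rewrite inE.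
by exists (cast_ord E (enum_rank_in iC i)); rewrite cast_ordK enum_rankK_in.
Qed.

(** * Rank one matrices vanishing on a pattern *)

Section Segre.
Variables (C : closedFieldType) (m n : nat).
Implicit Types x y : 'M[C]_(m, n).

Lemma rank_le1P x : (\rank x <= 1)%N <-> exists (u : 'cV_m) (v : 'rV_n), x = u *m v.
Proof.
split=> [|[u [v ->]]]; last by rewrite (leq_trans (mxrankM_maxl _ _)) // rank_leq_col.
have := mulmx_base x; move: (col_base x) (row_base x); case: (\rank x) => [|[|//]] a b <- _.
  by exists 0, 0; rewrite mul0mx [a]thinmx0 mul0mx.
by exists a, b.
Qed.

Lemma rank_le1_minors x :
  (forall i j k l, x i j * x k l = x i l * x k j) -> (\rank x <= 1)%N.
Proof.
move=> minors; have [->|x0] := eqVneq x 0; first by rewrite mxrank0.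
have [i [j xij]] : exists i j, x i j != 0.
  have [/existsP[i /existsP[j xij]]|] := boolP [exists i, exists j, x i j != 0].
    by exists i, j.
  rewrite negb_exists => /forallP N; case/eqP: x0; apply/matrixP => i j.
  have := N i; rewrite negb_exists => /forallP/(_ j); rewrite negbK mxE.
  by move/eqP.
apply/rank_le1P; exists (\col_k x k j), (\row_l (x i l / x i j)).
apply/matrixP => k l; rewrite outer_mxE !mxE; apply: (mulIf xij).
by rewrite mulrA mulfVK // mulrC minors mulrC.
Qed.

Lemma rank_le1_pattern_closed (S : {set 'I_m * 'I_n}) :
  zariski_closed (rank_le1_pattern C S).
Proof.
exists [set p | (exists i j k l, p = coord_poly C i j * coord_poly C k l
                              - coord_poly C i l * coord_poly C k j) \/
                exists2 ij, ij \in S & p = coord_poly C ij.1 ij.2].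
apply/seteqP; split=> [x [/rank_le1P[u [v ->]] xS] p|x xI].
  case=> [[i [j [k [l ->]]]]|[[i j] ijS ->]]; last by rewrite mxevalX xS.
  by rewrite mxevalD mxevalN !mxevalM !mxevalX !outer_mxE; ring.
split=> [|i j ijS]; last first.
  by rewrite -mxevalX; apply: xI; right; exists (i, j).
apply: rank_le1_minors => i j k l; apply/eqP; rewrite -subr_eq0; apply/eqP.
rewrite -(mxevalX x i j) -(mxevalX x k l) -(mxevalX x i l) -(mxevalX x k j).
by rewrite -!mxevalM -mxevalN -mxevalD; apply: xI; left; exists i, j, k, l.
Qed.

(** The zeros of u and of v form a cover of S on which [u *m v] vanishes. *)
Lemma rank_le1_cover (S : {set 'I_m * 'I_n}) x : rank_le1_pattern C S x ->
  exists2 A, A \in MC S & forall i j, (i, j) \in rect_pattern A -> x i j = 0.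
Proof.
move=> [/rank_le1P[u [v ->]] xS].
pose A := ([set i | u i 0 == 0], [set j | v 0 j == 0])%SET.
have AE i j : ((i, j) \in rect_pattern A) = ((u *m v) i j == 0).
  by rewrite outer_mxE mulf_eq0 rect_patternE !inE.
have [|B BS BA] := @MC_exists _ _ S A.
  by apply/fintype.subsetP => -[i j] /xS; rewrite AE => ->.
by exists B => // i j /(fintype.subsetP BA); rewrite AE => /eqP.
Qed.

End Segre.

(** * Counting the critical points *)

Section Components.
Variables (C : numClosedFieldType) (m n : nat) (S : {set 'I_m * 'I_n}).
Hypothesis S_proper : S != [set: 'I_m * 'I_n]%SET.
Local Notation X := (rank_le1_pattern C S).
Implicit Types A B : {set 'I_m} * {set 'I_n}.

Definition component_seq A (U : 'M[C]_(m, n)) (s : seq 'M[C]_(m, n)) :=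
  [/\ uniq s, size s = minn (m - #|A.1|) (n - #|A.2|),
    forall x, x \in s -> critical_points X U x /\
      forall i j, (x i j == 0) = ((i, j) \in rect_pattern A) &
    forall x, critical_points X U x ->
      (forall i j, (i, j) \in rect_pattern A -> x i j = 0) -> x \in s].

(** For every other minimal cover B choose a position in the pattern of B and
    not in that of A: the product of these coordinates vanishes on the cones of
    all B other than A. *)
Lemma component_isolating A : A \in MC S ->
  exists h : {mpoly C[m * n]},
    (forall x : 'M_(m, n), (forall i j, (i, j) \notin rect_pattern A -> x i j != 0) ->
       mxeval h x != 0) /\
    (forall x : 'M_(m, n), X x -> mxeval h x != 0 ->
       forall i j, (i, j) \in rect_pattern A -> x i j = 0).
Proof.
move=> AS.
have /choice[w wP] B : exists ij, B \in MC S -> B != A ->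
    (ij \in rect_pattern B) && (ij \notin rect_pattern A).
  have [ij ijP|N] := pickP [pred ij | (ij \in rect_pattern B) && (ij \notin rect_pattern A)].
    by exists ij.
  have [i0 [j0 _]] := MC_notin S_proper AS.
  exists (i0, j0) => BS; case/eqP; apply: (MC_inj S_proper BS AS).
  apply/fintype.subsetP => ij ijB; have /negbT := N ij.
  by rewrite /= ijB negbK.
exists (\prod_(B in MC S | B != A) coord_poly C (w B).1 (w B).2); split=> x.
  move=> x0; rewrite mxeval_prod prodf_seq_neq0; apply/allP => B _ /=.
  apply/implyP => /andP[BS BA]; rewrite mxevalX x0 // -surjective_pairing.
  by have /andP[] := wP B BS BA.
move=> /rank_le1_cover[B BS xB]; rewrite mxeval_prod => hx.
suff -> : A = B by [].
apply/eqP; apply: contraNT hx; rewrite eq_sym => BA.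
rewrite (bigD1 B) ?BS //= mxevalX xB ?mul0r // -surjective_pairing.
by have /andP[] := wP B BS BA.
Qed.

(** For a matrix that vanishes on the pattern of A, being critical on X amounts
    to being a critical point of rank one for the restriction of U to the
    rectangle, provided that this restriction is in [good_mx]. *)
Lemma generic_component A : A \in MC S ->
  generic [set U : 'M[C]_(m, n) | exists s, component_seq A U s].
Proof.
move=> AS; have [i0 [j0 [iA jA]]] := MC_notin S_proper AS.
have [r [f [f_inj fA rE]]] := index_set iA.
have [c [g [g_inj gA cE]]] := index_set jA.
have outE i j : ((i \notin codom f) || (j \notin codom g)) = ((i, j) \in rect_pattern A).
  by rewrite rect_patternE fA gA !negbK.
have X_segre (u : 'cV[C]_r.+1) (v : 'rV[C]_c.+1) : X (ext_mx f g (u *m v)).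
  split.
    apply/rank_le1P; exists ((select_mx C f)^T *m u), (v *m select_mx C g).
    exact: ext_mx_mul.
  by move=> i j /(fintype.subsetP (MC_sub AS)); rewrite -outE => ij; rewrite ext_mx_out.
have X_rect x : X x -> (forall i j, (i, j) \in rect_pattern A -> x i j = 0) ->
    exists (u : 'cV[C]_r.+1) (v : 'rV[C]_c.+1), x = ext_mx f g (u *m v).
  move=> [/rank_le1P[u [v ->]] _] x0.
  exists (select_mx C f *m u), (v *m (select_mx C g)^T).
  by rewrite -res_mx_mul res_mxK // => i j; rewrite outE; apply: x0.
have [h [h_neq0 h_local]] := component_isolating AS.
have X_local y : X y -> mxeval h y != 0 ->
    exists (u : 'cV[C]_r.+1) (v : 'rV[C]_c.+1), y = ext_mx f g (u *m v).
  by move=> Xy hy; apply: X_rect => //; apply: h_local.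
have res_mxB (x y : 'M[C]_(m, n)) : res_mx f g (x - y) = res_mx f g x - res_mx f g y.
  by rewrite /res_mx mulmxBr mulmxBl.
have := @generic_preimage C m n _ _ (res_mx f g) (res_mx f g (generic_mx C m n)) _ _ _
  (generic_good C (ltn0Sn r) (ltn0Sn c)).
move=> gen; apply: (genericS _ (gen _ _)) => [U [/= U0 [s [us ss sc s0]]]|U|y]; first last.
- by exists (ext_mx f g y); rewrite ext_mxK.
- apply/matrixP => k l; rewrite [RHS]mxE !res_mxE mxE; exact/esym/mxevalX.
exists [seq ext_mx f g y | y <- s]; split.
- by rewrite map_inj_uniq //; apply: can_inj (ext_mxK f_inj g_inj).
- by rewrite size_map ss rE cE.
- move=> _ /mapP[y ys ->].
  have zeroE i j : (ext_mx f g y i j == 0) = ((i, j) \in rect_pattern A).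
    rewrite -outE; have [ij|] := boolP (_ || _); first by rewrite ext_mx_out ?eqxx.
    rewrite negb_or !negbK => /andP[/codomP[k ->] /codomP[l ->]].
    by rewrite ext_mxE //; have := s0 y k l ys => /negPf ->.
  split=> //; have /sc[u [v [yE y0 Uv uU]]] := ys.
  have := s0 _ 0 0 ys; rewrite yE outer_mxE mulf_eq0 negb_or => /andP[u0 v0].
  pose u' := (u 0 0)^-1 *: u; pose v' := u 0 0 *: v.
  have uvE : y = u' *m v' by rewrite yE -scalemxAl -scalemxAr scalerA mulVf // scale1r.
  have u'0 : u' 0 0 = 1 by rewrite mxE mulVf.
  have v'0 : v' 0 0 != 0 by rewrite mxE mulf_neq0.
  have hx : mxeval h (ext_mx f g (u' *m v')) != 0.
    by apply: h_neq0 => i j; rewrite -uvE -zeroE.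
  rewrite -yE uvE; split.
    exact: (segre_smooth f_inj g_inj (rank_le1_pattern_closed C S) X_segre
      X_local u'0 v'0 hx).
  move=> V /(tangent_segre f_inj g_inj X_local u'0 v'0 hx)[a [b [_ ->]]].
  rewrite frobenius_ext res_mxB ext_mxK //; move: a b; apply/frobenius_segre.
  rewrite -uvE yE; split.
    by rewrite linearZ /= -scalemxAr mulmxBl Uv -mulmxA subrr scaler0.
  by rewrite linearZ /= -scalemxAl mulmxBr uU mulmxA subrr scaler0.
move=> x [[Xx _] xU] x0.
have [u [v xE]] := X_rect x Xx x0.
have critE (a : 'cV[C]_r.+1) (b : 'rV[C]_c.+1) : x = ext_mx f g (a *m b) ->
    (res_mx f g U - a *m b) *m b^T = 0 /\ a^T *m (res_mx f g U - a *m b) = 0.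
  move=> E; apply/frobenius_segre => a' b'.
  rewrite -[a *m b](ext_mxK f_inj g_inj) -E -res_mxB -frobenius_ext; apply: xU.
  by rewrite E; apply: segre_tangent.
rewrite xE; apply: map_f; apply/sc; exists u, v.
have [Duv uD] := critE _ _ xE; split=> //.
- apply: contraNneq U0 => uv0; apply/eqP/matrixP => k l.
  have [|+ _] := critE 0 (delta_mx 0 l); first by rewrite mul0mx xE uv0.
  rewrite mul0mx subr0 trmx_delta -colE => /colP/(_ k).
  by rewrite mxE => ->; rewrite !mxE.
- by apply/eqP; rewrite mulmxA -subr_eq0 -mulmxBl Duv.
- by apply/eqP; rewrite -mulmxA -subr_eq0 -mulmxBr uD.
Qed.

End Components.

Lemma card_eq_seq (T : choiceType) (s : seq T) : uniq s -> ([set` s] #= `I_(size s))%card.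
Proof.
move=> us; apply/card_set_bijP; exists (index^~ s); split.
- by move=> x /= xs; rewrite index_mem.
- move=> x y; rewrite !inE /= => xs ys E.
  by rewrite -(nth_index x xs) E nth_index.
- move=> k /= ks; case: s us ks => // x0 s us ks.
  by exists (nth x0 (x0 :: s) k); [apply: mem_nth|apply: index_uniq].
Qed.

Theorem EDdegree_rank_le1_pattern (C : numClosedFieldType) m n
    (S : {set 'I_m * 'I_n}) : S != [set: 'I_m * 'I_n]%SET ->
  has_EDdegree (rank_le1_pattern C S)
    (\sum_(A in MC S) minn (m - #|A.1|) (n - #|A.2|))%N.
Proof.
move=> SN.
have genA (A : {set 'I_m} * {set 'I_n}) :
    generic [set U : 'M[C]_(m, n) | A \in MC S -> exists s, component_seq S A U s].
  have [AS|_] := boolP (A \in MC S).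
    by apply: genericS (generic_component C SN AS) => U sU _.
  by apply: genericS (genericT C m n).
have [p [[U0 pU0] pG]] := @generic_forall C m n _
  (fun A => [set U | A \in MC S -> exists s, component_seq S A U s])
  genA.
exists (zero_locus [set p]); split.
- by exists [set p].
- move=> E; have : zero_locus [set p] U0 by rewrite E.
  by move/(_ p erefl) => p0; rewrite p0 eqxx in pU0.
move=> U ZU; have pU : mxeval p U != 0.
  by apply/eqP => p0; apply: ZU => q ->.
have {pG} /choice[s sP] A : exists s, A \in MC S -> component_seq S A U s.
  have [AS|] := boolP (A \in MC S); last by exists [::].
  by have [s sP] := pG U pU A AS; exists s.
pose L := flatten [seq s A | A <- enum (MC S)].
have memL x : x \in L <-> critical_points (rank_le1_pattern C S) U x.
  split=> [/flattenP[_ /mapP[A +->]]|cx].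
    by rewrite mem_enum => AS xs; have [_ _ /(_ x xs)[]] := sP A AS.
  have [A AS xA] := rank_le1_cover cx.1.1; have [_ _ _ sA] := sP A AS.
  by apply/flattenP; exists (s A); [apply: map_f; rewrite mem_enum|apply: sA].
have uniqL : uniq L.
  rewrite /L; have : uniq (enum (MC S)) by apply: enum_uniq.
  have : {subset enum (MC S) <= MC S} by move=> A; rewrite mem_enum.
  elim: (enum (MC S)) => //= A l IH sub /andP[Al ul].
  have AS : A \in MC S by apply: sub; rewrite mem_head.
  have [uA _ sA _] := sP A AS.
  rewrite cat_uniq uA IH //= ?andbT; last by move=> B Bl; apply: sub; rewrite inE Bl orbT.
  apply/hasPn => x /flattenP[_ /mapP[B Bl ->]] xB; apply: contraNN Al => xA.
  have BS : B \in MC S by apply: sub; rewrite inE Bl orbT.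
  have [_ _ sB _] := sP B BS; suff -> : A = B by [].
  apply: (MC_inj SN AS BS); apply/fintype.subsetP => -[i j].
  by rewrite -(sA x xA).2 (sB x xB).2.
have sizeL : size L = (\sum_(A in MC S) minn (m - #|A.1|) (n - #|A.2|))%N.
  rewrite size_flatten /shape -map_comp sumnE big_map big_enum /=.
  by apply: eq_bigr => A AS; have [] := sP A AS.
rewrite -sizeL; suff -> : critical_points (rank_le1_pattern C S) U = [set` L].
  exact: card_eq_seq.
by apply/seteqP; split=> x /memL.
Qed.

Theorem proposition3p3 (R : realType) (m n : nat) (S : {set 'I_m * 'I_n})
    (hS : S != [set: 'I_m * 'I_n]%SET) :
  has_EDdegree (rank_le1_pattern R[i] S)
    (\sum_(A in MC S) minn (m - #|A.1|) (n - #|A.2|))%N.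
Proof. exact: EDdegree_rank_le1_pattern. Qed.
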